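(* Let $\mathcal S$ be a routing net, $I$ the set of free ports of $\mathcal S$ that are the source port of a wire and $O$ the set of free ports that are the end port of a wire. Then $[\![\mathcal S]\!]$ is the multirelation between $I$ and $O$ given by $[\![\mathcal S]\!](i,o)=|P_f(\mathcal S,i,o)|$, the number of paths in $\mathcal S$ starting at $i$ and ending at $o$.
   Context: A multirelation between finite sets $A$ and $B$ is a map $A\times B\to\mathbb N$. A routing net is a net correct for the Ehrhard–Regnier correctness criterion for differential proof nets, composed only of weakenings (0-ary $?$), coweakenings (0-ary $!$), contractions (binary $?$), cocontractions (binary $!$) and possibly floating wires, all wires labelled by the same formula $!A$ (fixing orientation: each wire $w$ has a source port $s(w)$ and an end port $e(w)$). Nets are considered modulo associativity/commutativity of (co)contraction and neutrality of (co)weakening; reduction rules: (ba) contraction facing cocontraction replaced by two contractions and two cocontractions connected crosswise; (s1) coweakening facing contraction becomes two coweakenings; (s2) cocontraction facing weakening becomes two weakenings; ($\epsilon$) coweakening facing weakening is erased. A routing area $(I,O,R)$ is the net with inputs labelled by $I$ each connected to the principal port of a contraction tree, outputs labelled by $O$ each connected to the principal port of a cocontraction tree, the tree of $i$ connected to the tree of $o$ by exactly $R(i,o)$ wires. The normal form of a routing net is a routing area, and $[\![\mathcal S]\!]$ denotes the multirelation $R$ describing the routing area that is the normal form of $\mathcal S$ (its inputs and outputs being the free ports of $\mathcal S$). Paths: in the undirected graph with ports as vertices, a wire edge $s(w)$–$e(w)$ per wire and a cell edge between each auxiliary port of a cell and its principal port, a path is a sequence $(p_1,e_1,\dots,e_n,p_{n+1})$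 of ports and edges, $e_k$ linking $p_k,p_{k+1}$, with consecutive edges of distinct nature (wire/cell); it starts at $p_1$ and ends at $p_{n+1}$. *)

(* Defs.v *)
From HB Require Import structures.
From Stdlib Require Import Relation_Operators.
From mathcomp Require Import all_boot finmap.
From mathcomp Require Import boolp classical_sets cardinality.

Set Implicit Arguments.
Unset Strict Implicit.
Unset Printing Implicit Defensive.

Local Open Scope nat_scope.

Definition port := nat.

(** A net is a finite multiset of wires and cells connected through named
    ports.  All wires are labelled [!A], oriented so that the principal port of
    a contraction or weakening is the end of a wire and its auxiliary ports are
    sources; dually for cocontractions and coweakenings. *)
Inductive component : Type :=
| Wire     (s e : port)     (* source and end *)
| Contr    (p a b : port)   (* principal port, auxiliary ports *)
| Cocontr  (p a b : port)
| Weak     (p : port)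
| Coweak   (p : port).

Definition component_code (c : component) : nat * seq port :=
  match c with
  | Wire s e => (0, [:: s; e])
  | Contr p a b => (1, [:: p; a; b])
  | Cocontr p a b => (2, [:: p; a; b])
  | Weak p => (3, [:: p])
  | Coweak p => (4, [:: p])
  end.

Definition component_decode (x : nat * seq port) : option component :=
  match x with
  | (0, [:: s; e]) => Some (Wire s e)
  | (1, [:: p; a; b]) => Some (Contr p a b)
  | (2, [:: p; a; b]) => Some (Cocontr p a b)
  | (3, [:: p]) => Some (Weak p)
  | (4, [:: p]) => Some (Coweak p)
  | _ => None
  end.

Lemma component_codeK : pcancel component_code component_decode.
Proof. by case. Qed.

HB.instance Definition _ := Equality.copy component (pcan_type component_codeK).

Definition wire_sources (S : seq component) : seq port :=
  flatten [seq if c is Wire s _ then [:: s] else [::] | c <- S].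

Definition wire_ends (S : seq component) : seq port :=
  flatten [seq if c is Wire _ e then [:: e] else [::] | c <- S].

(** Cell ports that must be the source (resp. the end) of the wire they are
    attached to. *)
Definition cell_sources (S : seq component) : seq port :=
  flatten [seq match c with
               | Contr _ a b => [:: a; b]
               | Cocontr p _ _ => [:: p]
               | Coweak p => [:: p]
               | _ => [::]
               end | c <- S].

Definition cell_ends (S : seq component) : seq port :=
  flatten [seq match c with
               | Cocontr _ a b => [:: a; b]
               | Contr p _ _ => [:: p]
               | Weak p => [:: p]
               | _ => [::]
               end | c <- S].

Definition wire_ports S := wire_sources S ++ wire_ends S.
Definition cell_ports S := cell_sources S ++ cell_ends S.

(** Every port belongs to exactly one wire and to at most one cell, with the
    orientations above. *)
Definition well_formed (S : seq component) : bool :=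
  [&& uniq (wire_ports S), uniq (cell_ports S),
      all (mem (wire_sources S)) (cell_sources S)
    & all (mem (wire_ends S)) (cell_ends S)].

Record net := Net {
  components :> seq component;
  net_well_formed : well_formed components }.

Definition inputs (S : net) : {fset port} :=
  seq_fset tt [seq p <- wire_sources S | p \notin cell_ports S].

Definition outputs (S : net) : {fset port} :=
  seq_fset tt [seq p <- wire_ends S | p \notin cell_ports S].

Definition multirelation (A B : {fset port}) := {ffun A * B -> nat}.

(** ** Port graph, paths and correctness *)

(** [inl (s, e)] is a wire edge, [inr (a, p)] a cell edge between an auxiliary
    port [a] and a principal port [p]; edges are traversed in both directions. *)
Definition edge := ((port * port) + (port * port))%type.

Definition edge_ends (x : edge) : port * port :=
  match x with inl w => w | inr c => c end.

Definition links (x : edge) (p q : port) : bool :=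
  (edge_ends x == (p, q)) || (edge_ends x == (q, p)).

Definition wire_edges (S : seq component) : seq edge :=
  flatten [seq if c is Wire s e then [:: inl (s, e)] else [::] | c <- S].

Definition cell_edges (S : seq component) : seq edge :=
  flatten [seq match c with
               | Contr p a b | Cocontr p a b => [:: inr (a, p); inr (b, p)]
               | _ => [::]
               end | c <- S].

Definition edges (S : seq component) : seq edge := wire_edges S ++ cell_edges S.

(** The sequence [(p1, e1, p2, ..., en, pn+1)] is represented by
    [(p1, [:: (e1, p2); ...; (en, pn+1)])]. *)
Definition trail := (port * seq (edge * port))%type.

Definition trail_start (t : trail) : port := t.1.
Definition trail_stop (t : trail) : port := last t.1 (unzip2 t.2).
Definition trail_edges (t : trail) : seq edge := unzip1 t.2.

Fixpoint walk (E : seq edge) (p : port) (st : seq (edge * port)) : bool :=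
  if st is (x, q) :: st' then [&& x \in E, links x p q & walk E q st'] else true.

Definition is_wire_edge (x : edge) : bool := if x is inl _ then true else false.

Definition is_path (S : net) (t : trail) : bool :=
  walk (edges S) t.1 t.2 &&
  sorted (fun x y => is_wire_edge x != is_wire_edge y) (trail_edges t).

Definition paths (S : net) (i o : port) : set trail :=
  [set t : trail | [/\ is_path S t, trail_start t = i & trail_stop t = o]]%classic.

(** A switching [sw] selects one auxiliary port of each contraction (identified
    by its principal port) and keeps only the corresponding cell edge. *)
Definition switched_cell_edges (sw : port -> bool) (S : seq component) : seq edge :=
  flatten [seq match c with
               | Contr p a b => [:: inr (if sw p then a else b, p)]
               | Cocontr p a b => [:: inr (a, p); inr (b, p)]
               | _ => [::]
               end | c <- S].

Definition is_cycle (E : seq edge) (t : trail) : bool :=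
  [&& t.2 != [::], walk E t.1 t.2, trail_stop t == trail_start t,
      uniq (trail_edges t) & uniq (unzip2 t.2)].

(** Switching graphs are only required to be acyclic: with weakenings and
    coweakenings they need not be connected. *)
Definition correct (S : net) : Prop :=
  forall (sw : port -> bool) (t : trail),
    ~~ is_cycle (wire_edges S ++ switched_cell_edges sw S) t.

Definition routing_net (S : net) : Prop := correct S.

(** ** Structural equivalence and reduction *)

Definition rename (f : port -> port) (c : component) : component :=
  match c with
  | Wire s e => Wire (f s) (f e)
  | Contr p a b => Contr (f p) (f a) (f b)
  | Cocontr p a b => Cocontr (f p) (f a) (f b)
  | Weak p => Weak (f p)
  | Coweak p => Coweak (f p)
  end.

(** Port names are irrelevant, except those of the free ports. *)
Definition renaming (S S' : net) : Prop :=
  exists f : port -> port,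
    [/\ {in wire_ports S &, injective f},
        {in wire_ports S, forall p, p \notin cell_ports S -> f p = p}
      & perm_eq S' (map (rename f) S)].

(** Application of a local rule inside an arbitrary context.  As [S] and [S']
    are both well formed, ports occurring in only one side of a rule are fresh
    with respect to the context. *)
Definition in_context (rule : seq component -> seq component -> Prop)
    (S S' : net) : Prop :=
  exists l r ctx : seq component,
    [/\ rule l r, perm_eq S (l ++ ctx) & perm_eq S' (r ++ ctx)].

Inductive structural_rule : seq component -> seq component -> Prop :=
| ContrC p a b :
    structural_rule [:: Contr p a b] [:: Contr p b a]
| ContrA p a b b' c d :
    structural_rule [:: Contr p a b; Wire b b'; Contr b' c d]
                    [:: Contr p b d; Wire b b'; Contr b' a c]
| ContrN x p a b b' y :
    structural_rule [:: Wire x p; Contr p a b; Wire b b'; Weak b'; Wire a y]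
                    [:: Wire x y]
| CocontrC p a b :
    structural_rule [:: Cocontr p a b] [:: Cocontr p b a]
| CocontrA p a b b' c d :
    structural_rule [:: Cocontr p a b; Wire b' b; Cocontr b' c d]
                    [:: Cocontr p b d; Wire b' b; Cocontr b' a c]
| CocontrN x p a b b' y :
    structural_rule [:: Wire p y; Cocontr p a b; Wire b' b; Coweak b'; Wire x a]
                    [:: Wire x y].

Definition equiv : net -> net -> Prop :=
  clos_refl_sym_trans net
    (fun S S' => renaming S S' \/ in_context structural_rule S S').

Inductive reduction_rule : seq component -> seq component -> Prop :=
| red_ba q a b p c d ac ca ad da bc cb bd db :
    reduction_rule
      [:: Cocontr q a b; Wire q p; Contr p c d]
      [:: Contr a ac ad; Contr b bc bd; Cocontr c ca cb; Cocontr d da db;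
          Wire ac ca; Wire ad da; Wire bc cb; Wire bd db]
| red_s1 q p c d :
    reduction_rule [:: Coweak q; Wire q p; Contr p c d]
                   [:: Coweak c; Coweak d]
| red_s2 q a b p :
    reduction_rule [:: Cocontr q a b; Wire q p; Weak p]
                   [:: Weak a; Weak b]
| red_eps q p :
    reduction_rule [:: Coweak q; Wire q p; Weak p] [::].

Definition step : net -> net -> Prop := in_context reduction_rule.

(** Reduction of nets modulo structural equivalence. *)
Definition reduces : net -> net -> Prop :=
  clos_refl_trans net (fun S S' => equiv S S' \/ step S S').

(** Normality is a property of a representative: by neutrality every wire is
    equivalent to a net containing a cocontraction facing a contraction. *)
Definition normal (S : net) : Prop := forall S' : net, ~ step S S'.

(** ** Routing areas *)

(** [contr_tree x l T]: [T] is a contraction tree plugged at the source port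
    [x], whose leaves are the source ports [l].  A tree is a mere wire (a single
    leaf, the port [x] itself), a weakening, or a contraction with a tree plugged
    at each auxiliary port. *)
Inductive contr_tree : port -> seq port -> seq component -> Prop :=
| contr_tree_wire x : contr_tree x [:: x] [::]
| contr_tree_weak x p : contr_tree x [::] [:: Wire x p; Weak p]
| contr_tree_node x p a b la lb Ta Tb :
    contr_tree a la Ta -> contr_tree b lb Tb ->
    contr_tree x (la ++ lb) ([:: Wire x p; Contr p a b] ++ Ta ++ Tb).

Inductive cocontr_tree : port -> seq port -> seq component -> Prop :=
| cocontr_tree_wire y : cocontr_tree y [:: y] [::]
| cocontr_tree_coweak y p : cocontr_tree y [::] [:: Wire p y; Coweak p]
| cocontr_tree_node y p a b la lb Ta Tb :
    cocontr_tree a la Ta -> cocontr_tree b lb Tb ->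
    cocontr_tree y (la ++ lb) ([:: Wire p y; Cocontr p a b] ++ Ta ++ Tb).

(** [W] lists the wires from the leaves of the trees of the inputs to the leaves
    of the trees of the outputs; each leaf is used by exactly one of them. *)
Definition routing_area (I O : {fset port}) (R : multirelation I O) (S : net) : Prop :=
  exists (lI : I -> seq port) (TI : I -> seq component)
         (lO : O -> seq port) (TO : O -> seq component)
         (W : seq (port * port)),
    [/\ (forall i, contr_tree (val i) (lI i) (TI i)) /\
        (forall o, cocontr_tree (val o) (lO o) (TO o)),
        perm_eq (unzip1 W) (flatten [seq lI i | i : I]),
        perm_eq (unzip2 W) (flatten [seq lO o | o : O]),
        (forall i o, R (i, o) = count (fun w => (w.1 \in lI i) && (w.2 \in lO o)) W)
      & perm_eq S (flatten [seq TI i | i : I] ++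
                   flatten [seq TO o | o : O] ++
                   [seq Wire w.1 w.2 | w <- W])].

(** [R] describes a routing area that is a normal form of [S]. *)
Definition describes_normal_form (S : net)
    (R : multirelation (inputs S) (outputs S)) : Prop :=
  exists S' : net, [/\ reduces S S', normal S' & routing_area R S'].

(** The semantics of [S]; it is only meaningful if the normal form exists and
    determines [R], hence the zero default value. *)
Definition interp (S : net) : multirelation (inputs S) (outputs S) :=
  xget [ffun=> 0] [set R | describes_normal_form R]%classic.

(* Main.v *)
Require Import Defs.
From Stdlib Require Import Relation_Operators.
From mathcomp Require Import all_boot finmap.
From mathcomp Require Import boolp classical_sets cardinality.
From mathcomp Require Import zify.

(* The semantics is read off solutions of the linear system attached to a net: a label for each
   port, transmitted by wires, copied by contractions, summed by cocontractions, null at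
   coweakenings. Every structural rule and every reduction rule transports the solutions (in both
   directions for the former), without changing the labels of the free ports. In a routing area
   the system can be solved by hand: an input labelled 1, the others being labelled 0, forces the
   label R(i, o) at the output o. In a correct net there is no directed cycle, and the numbers of
   paths from i form such a solution, because the alternation of wires and cells forces a path
   from an input to follow the orientation. Hence R(i, o) is the number of paths.

   For existence, adding 1 at each cocontraction and coweakening makes the solution count the
   directed paths from these cells; summed over the principal ports of contractions and
   weakenings it decreases by 1 at each reduction step. A normal net without directed cycle is
   literally a routing area: no wire goes from a cocontraction or coweakening to a contraction or
   weakening, so that contractions and weakenings form forests rooted at the inputs, and dually. *)

Local Open Scope card_scope.

(** ** Port lists *)

Lemma perm_flatten_map {T : eqType} (f : component -> seq T) {S S' : seq component} :
  perm_eq S S' -> perm_eq (flatten (map f S)) (flatten (map f S')).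
Proof. by move=> e; apply/perm_flatten/perm_map. Qed.

Lemma perm_wire_ports {S S'} : perm_eq S S' -> perm_eq (wire_ports S) (wire_ports S').
Proof. by move=> e; apply: perm_cat; apply: perm_flatten_map. Qed.

Lemma perm_cell_ports {S S'} : perm_eq S S' -> perm_eq (cell_ports S) (cell_ports S').
Proof. by move=> e; apply: perm_cat; apply: perm_flatten_map. Qed.

Lemma wire_sources_cat l r : wire_sources (l ++ r) = wire_sources l ++ wire_sources r.
Proof. by rewrite /wire_sources map_cat flatten_cat. Qed.

Lemma wire_ends_cat l r : wire_ends (l ++ r) = wire_ends l ++ wire_ends r.
Proof. by rewrite /wire_ends map_cat flatten_cat. Qed.

Lemma cell_sources_cat l r : cell_sources (l ++ r) = cell_sources l ++ cell_sources r.
Proof. by rewrite /cell_sources map_cat flatten_cat. Qed.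

Lemma cell_ends_cat l r : cell_ends (l ++ r) = cell_ends l ++ cell_ends r.
Proof. by rewrite /cell_ends map_cat flatten_cat. Qed.

Lemma perm_wire_ports_cat l r :
  perm_eq (wire_ports (l ++ r)) (wire_ports l ++ wire_ports r).
Proof. by rewrite /wire_ports wire_sources_cat wire_ends_cat perm_catACA. Qed.

Lemma perm_cell_ports_cat l r :
  perm_eq (cell_ports (l ++ r)) (cell_ports l ++ cell_ports r).
Proof. by rewrite /cell_ports cell_sources_cat cell_ends_cat perm_catACA. Qed.

Lemma mem_wire_ports_cat l r p :
  (p \in wire_ports (l ++ r)) = (p \in wire_ports l) || (p \in wire_ports r).
Proof. by rewrite (perm_mem (perm_wire_ports_cat l r)) mem_cat. Qed.

Lemma mem_cell_ports_cat l r p :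
  (p \in cell_ports (l ++ r)) = (p \in cell_ports l) || (p \in cell_ports r).
Proof. by rewrite (perm_mem (perm_cell_ports_cat l r)) mem_cat. Qed.

Lemma perm_well_formed {S S'} : perm_eq S S' -> well_formed S = well_formed S'.
Proof.
move=> e; rewrite /well_formed (perm_uniq (perm_wire_ports e)).
rewrite (perm_uniq (perm_cell_ports e)); congr [&& _, _, _ & _].
  rewrite (perm_all _ (perm_flatten_map _ e)); apply: eq_all => p.
  exact: (perm_mem (perm_flatten_map _ e)).
rewrite (perm_all _ (perm_flatten_map _ e)); apply: eq_all => p.
exact: (perm_mem (perm_flatten_map _ e)).
Qed.

Lemma cell_sourceW {S p} : well_formed S -> p \in cell_sources S -> p \in wire_sources S.
Proof. by case/and4P=> _ _ /allP h _ /h. Qed.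

Lemma cell_endW {S p} : well_formed S -> p \in cell_ends S -> p \in wire_ends S.
Proof. by case/and4P=> _ _ _ /allP h /h. Qed.

Lemma source_not_end {S p} : well_formed S -> p \in wire_sources S -> p \in wire_ends S = false.
Proof.
case/and4P; rewrite cat_uniq => /and3P[_ /hasPn h _] _ _ _ ps.
by apply/negP => /h; rewrite /= ps.
Qed.

Lemma cell_portW {S p} : well_formed S -> p \in cell_ports S -> p \in wire_ports S.
Proof.
by move=> wS; rewrite !mem_cat => /orP[/(cell_sourceW wS)->|/(cell_endW wS)->]; rewrite ?orbT.
Qed.

Definition ports_of (c : component) : seq port := (component_code c).2.

Lemma mem_ports_of {S c p} : c \in S -> p \in ports_of c ->
  (p \in wire_ports S) || (p \in cell_ports S).
Proof.
move=> cS pc.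
suff: [|| p \in wire_sources S, p \in wire_ends S, p \in cell_sources S | p \in cell_ends S].
  by rewrite !mem_cat -!orbA.
case: c cS pc => [s e|q a b|q a b|q|q] cS; rewrite !inE;
  do ?[case/orP|case/or3P]; move=> /eqP ->; apply/or4P.
all: try by [apply: Or41; apply/flatten_mapP; eexists; first exact: cS; rewrite !inE eqxx ?orbT].
all: try by [apply: Or42; apply/flatten_mapP; eexists; first exact: cS; rewrite !inE eqxx ?orbT].
all: try by [apply: Or43; apply/flatten_mapP; eexists; first exact: cS; rewrite !inE eqxx ?orbT].
all: try by [apply: Or44; apply/flatten_mapP; eexists; first exact: cS; rewrite !inE eqxx ?orbT].
Qed.

Lemma mem_ports_ofW {S c p} : well_formed S -> c \in S -> p \in ports_of c -> p \in wire_ports S.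
Proof. by move=> wS cS /(mem_ports_of cS)/orP[//|/(cell_portW wS)]. Qed.

(** ** Local updates of port labellings *)

Definition local (sat : (port -> nat) -> component -> bool) :=
  forall v v' c, {in ports_of c, v =1 v'} -> sat v c = sat v' c.

(** A port lies on at most one wire and one cell, so such a port is out of reach of the context and
    may be relabelled by a rule. *)
Definition internal (S : seq component) (p : port) : bool :=
  (p \in wire_ports S) && (p \in cell_ports S).

Definition update_of (r : seq component) (v v' : port -> nat) :=
  forall p, ~~ internal r p -> v' p = v p.

Lemma internal_fresh {r ctx c p} : well_formed (r ++ ctx) -> c \in ctx ->
  p \in ports_of c -> ~~ internal r p.
Proof.
case/and4P; rewrite (perm_uniq (perm_wire_ports_cat _ _)) (perm_uniq (perm_cell_ports_cat _ _)).
rewrite !cat_uniq => /and3P[_ /hasPn h1 _] /and3P[_ /hasPn h2 _] _ _ cc pc.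
apply/negP => /andP[p1 p2].
by case/orP: (mem_ports_of cc pc) => [/h1|/h2] /=; rewrite ?p1 ?p2.
Qed.

Lemma update_of_ctx {r ctx c v v'} : well_formed (r ++ ctx) -> update_of r v v' ->
  c \in ctx -> {in ports_of c, v' =1 v}.
Proof. by move=> w u cc p pc; apply/u/(internal_fresh w cc pc). Qed.

(** Reduces transport through a rule in context to the two sides of the rule alone, since the
    context sees no changed label. *)
Lemma all_update {sat l r ctx v v'} : local sat -> well_formed (r ++ ctx) ->
  update_of r v v' -> all (sat v) (l ++ ctx) -> all (sat v') r -> all (sat v') (r ++ ctx).
Proof.
move=> loc w u; rewrite !all_cat => /andP[_ /allP h] -> /=.
by apply/allP => c cc; rewrite (loc _ v) ?h //; apply: update_of_ctx w u cc.
Qed.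

(** * The linear system of labels and its transport by the rules *)

(** With [k = 0], the system whose solutions are compared across reduction; [k = 1] puts a unit
    source at each cocontraction and coweakening and yields the termination measure. *)
Definition flow (k : nat) (v : port -> nat) (c : component) : bool :=
  match c with
  | Wire s e => v e == v s
  | Contr p a b => (v a == v p) && (v b == v p)
  | Cocontr p a b => v p == v a + v b + k
  | Weak _ => true
  | Coweak p => v p == k
  end.

(** A rank witnessing the absence of directed cycles, phrased component by component so that it can
    be carried through a rule by a local update. *)
Definition increasing (h : port -> nat) (c : component) : bool :=
  match c with
  | Wire s e => h s < h e
  | Contr p a b => (h p < h a) && (h p < h b)
  | Cocontr p a b => (h a < h p) && (h b < h p)
  | _ => true
  end.

Definition load (v : port -> nat) (c : component) : nat :=
  match c with Contr p _ _ | Weak p => v p | _ => 0 end.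

Lemma local_flow k : local (flow k).
Proof. by move=> v v' [s e|p a b|p a b|p|p] u //=; rewrite !u // !inE eqxx ?orbT. Qed.

Lemma local_increasing : local increasing.
Proof. by move=> v v' [s e|p a b|p a b|p|p] u //=; rewrite !u // !inE eqxx ?orbT. Qed.

Lemma load_update {r ctx v v'} : well_formed (r ++ ctx) -> update_of r v v' ->
  map (load v') ctx = map (load v) ctx.
Proof.
move=> w u; apply/eq_in_map => c cc; have := update_of_ctx w u cc.
by case: c {cc} => [s e|p a b|p a b|p|p] //= -> //; rewrite !inE eqxx.
Qed.

Definition override (v : port -> nat) (s : seq (port * nat)) : port -> nat :=
  foldr (fun x w z => if z == x.1 then x.2 else w z) v s.

Lemma override_out v s p : p \notin unzip1 s -> override v s p = v p.
Proof.
by elim: s => //= x s ih; rewrite inE negb_or => /andP[/negbTE -> /ih].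
Qed.

Lemma override_in v s p n : uniq (unzip1 s) -> (p, n) \in s -> override v s p = n.
Proof.
elim: s => //= x s ih /andP[xs us]; rewrite inE => /orP[/eqP <- /=|ps]; first by rewrite eqxx.
case: eqP => [px|_]; last exact: ih.
by case/negP: xs; rewrite -px; apply/mapP; exists (p, n).
Qed.

Lemma update_of_override r v s t u : perm_eq (wire_ports r) (unzip1 s ++ t) ->
  perm_eq (cell_ports r) (unzip1 s ++ u) -> update_of r v (override v s).
Proof.
move=> ew ec p pr; apply: override_out; apply: contra pr => ps.
by rewrite /internal (perm_mem ew) (perm_mem ec) !mem_cat ps.
Qed.

Lemma uniq_split (s t u : seq port) : uniq s -> perm_eq s (t ++ u) ->
  uniq t /\ {in u, forall z, z \notin t}.
Proof.
by move=> us e; move: us; rewrite (perm_uniq e) cat_uniq => /and3P[? /hasPn].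
Qed.

(** Permutations of explicit port lists are checked by counting: the value of an arbitrary predicate
    at each port becomes an unknown number, and equality of counts is linear arithmetic. *)
Ltac solve_perm :=
  apply/permP => ? /=;
  repeat match goal with |- context [nat_of_bool ?x] => move: (nat_of_bool x) => ? end;
  lia.
Ltac solve_in := apply: override_in => //; rewrite !inE eqxx ?orbT //.
Ltac solve_out H := apply: override_out; refine (H _ _); rewrite !inE eqxx ?orbT //.

(** The redex loads [v p], which is [k] when a coweakening faces it and [v a + v b + k] when a
    cocontraction does; the reduct loads 0 or [v a + v b] respectively. *)
Lemma flow_reduction {l r} k v : reduction_rule l r ->
  uniq (wire_ports r) -> uniq (cell_ports r) -> all (flow k v) l ->
  exists v', [/\ update_of r v v', all (flow k v') r &
    sumn (map (load v') r) + k = sumn (map (load v) l)].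
Proof.
case=> [q a b p c d ac ca ad da bc cb bd db|q p c d|q a b p|q p].
- move=> _ uc; rewrite /= !andbT => /and4P[/eqP q1 /eqP p1 /eqP c1 /eqP d1].
  (* The wires leaving the new contraction at [a] carry [v a], those leaving the one at [b] carry
     [v b]; the cocontractions at [c] and [d] then recompute [v q]. *)
  pose s := [:: (ac, v a); (ad, v a); (bc, v b); (bd, v b);
                (ca, v a); (da, v a); (cb, v b); (db, v b)].
  have [us out] : uniq (unzip1 s) /\ {in [:: a; b; c; d], forall z, z \notin unzip1 s}.
    by apply: uniq_split uc _; solve_perm.
  exists (override v s).
  have [oa ob oc od] : [/\ override v s a = v a, override v s b = v b,
      override v s c = v c & override v s d = v d] by split; solve_out out.
  have [i1 i2 i3 i4] : [/\ override v s ac = v a, override v s ad = v a,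
      override v s bc = v b & override v s bd = v b] by split; solve_in.
  have [j1 j2 j3 j4] : [/\ override v s ca = v a, override v s da = v a,
      override v s cb = v b & override v s db = v b] by split; solve_in.
  split; first by apply: (@update_of_override _ _ _ [::] [:: a; b; c; d]); solve_perm.
    move: (override v s) oa ob oc od i1 i2 i3 i4 j1 j2 j3 j4.
    by move=> v' /= -> -> -> -> -> -> -> -> -> -> -> ->; rewrite c1 d1 p1 q1 !eqxx.
  by move: (override v s) oa ob => v' /= *; lia.
- by move=> _ _; rewrite /= !andbT => /and4P[/eqP q1 /eqP p1 /eqP c1 /eqP d1];
  exists v; split => //=; lia.
- by move=> _ _ /= /and3P[/eqP q1 /eqP p1 _]; exists v; split=> //=; lia.
- by move=> _ _ /= /and3P[/eqP q1 /eqP p1 _]; exists v; split=> //=; lia.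
Qed.

Lemma increasing_reduction {l r} h : reduction_rule l r ->
  uniq (wire_ports r) -> uniq (cell_ports r) -> all (increasing h) l ->
  exists2 h', update_of r h h' & all (increasing h') r.
Proof.
case=> [q a b p c d ac ca ad da bc cb bd db|q p c d|q a b p|q p];
  try by move=> _ _ _; exists h.
move=> _ uc; rewrite /= !andbT => /and3P[/andP[q1 q2] p1 /andP[c1 d1]].
(* Fresh sources inherit the rank of [q] and fresh ends that of [p], so the new wires increase the
   rank as the old one did. *)
pose s := [:: (ac, h q); (ad, h q); (bc, h q); (bd, h q);
              (ca, h p); (da, h p); (cb, h p); (db, h p)].
have [us out] : uniq (unzip1 s) /\ {in [:: a; b; c; d], forall z, z \notin unzip1 s}.
  by apply: uniq_split uc _; solve_perm.
exists (override h s); first by apply: (@update_of_override _ _ _ [::] [:: a; b; c; d]); solve_perm.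
have [oa ob oc od] : [/\ override h s a = h a, override h s b = h b,
    override h s c = h c & override h s d = h d] by split; solve_out out.
have [i1 i2 i3 i4] : [/\ override h s ac = h q, override h s ad = h q,
    override h s bc = h q & override h s bd = h q] by split; solve_in.
have [j1 j2 j3 j4] : [/\ override h s ca = h p, override h s da = h p,
    override h s cb = h p & override h s db = h p] by split; solve_in.
move: (override h s) oa ob oc od i1 i2 i3 i4 j1 j2 j3 j4.
by move=> h' -> -> -> -> -> -> -> -> -> -> -> ->; rewrite q1 q2 p1 c1 d1.
Qed.

(** Only associativity of cocontractions relabels internal ports. Neutrality requires [k = 0]: a
    cocontraction with a coweakening would otherwise add twice [k]. *)
Lemma flow_structural {l r} v : structural_rule l r ->
  uniq (cell_ports r) -> all (flow 0 v) l ->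
  exists2 v', update_of r v v' & all (flow 0 v') r.
Proof.
case=> [p a b|p a b b' c d|x p a b b' y|p a b|p a b b' c d|x p a b b' y] uc;
  rewrite /= ?andbT ?addn0 -?andbA.
- by case/andP=> ? ?; exists v => //=; rewrite andbT; apply/andP.
- case/and5P => /eqP a1 /eqP b1 /eqP b2 /eqP c1 /eqP d1.
  by exists v => //=; lia.
- case/and5P => /eqP a1 /eqP b1 /eqP b2 /eqP c1 /eqP d1.
  by exists v => //=; lia.
- by move=> ?; exists v => //=; lia.
- case/and3P => /eqP p1 /eqP b1 /eqP b2.
  (* The inner cocontraction now sums [a] and [c], hence a new label on the wire from [b'] to
     [b]. *)
  pose s := [:: (b, v a + v c); (b', v a + v c)].
  have [us out] : uniq (unzip1 s) /\ {in [:: a; c; d; p], forall z, z \notin unzip1 s}.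
    by apply: uniq_split uc _; solve_perm.
  exists (override v s); first by apply: (@update_of_override _ _ _ [::] [:: a; c; d; p]); solve_perm.
  have [oa oc od op] : [/\ override v s a = v a, override v s c = v c,
      override v s d = v d & override v s p = v p] by split; solve_out out.
  have [i1 i2] : override v s b = v a + v c /\ override v s b' = v a + v c by split; solve_in.
  by move: (override v s) oa oc od op i1 i2 => v' /= *; lia.
- case/and5P => /eqP a1 /eqP b1 /eqP b2 /eqP c1 /eqP d1.
  by exists v => //=; lia.
Qed.

Lemma flow_structural_sym {l r} v : structural_rule r l ->
  uniq (wire_ports r) -> uniq (cell_ports r) -> all (flow 0 v) l ->
  exists2 v', update_of r v v' & all (flow 0 v') r.
Proof.
case=> [p a b|p a b b' c d|x p a b b' y|p a b|p a b b' c d|x p a b b' y] uw uc;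
  rewrite /= ?andbT ?addn0 -?andbA.
- by case/andP=> ? ?; exists v => //=; rewrite andbT; apply/andP.
- case/and5P => /eqP a1 /eqP b1 /eqP b2 /eqP c1 /eqP d1.
  by exists v => //=; lia.
- move=> /eqP e.
  (* Expanding a wire creates four ports; a contraction copies the label of [x] to all of them,
     including the weakened branch. *)
  pose s := [:: (p, v x); (a, v x); (b, v x); (b', v x)].
  have [us out] : uniq (unzip1 s) /\ {in [:: x; y], forall z, z \notin unzip1 s}.
    by apply: uniq_split uw _; solve_perm.
  exists (override v s); first by apply: (@update_of_override _ _ _ [:: x; y] [::]); solve_perm.
  have [ox oy] : override v s x = v x /\ override v s y = v y by split; solve_out out.
  have [i1 i2 i3 i4] : [/\ override v s p = v x, override v s a = v x,
      override v s b = v x & override v s b' = v x] by split; solve_in.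
  by move: (override v s) ox oy i1 i2 i3 i4 => v' /= *; lia.
- by move=> ?; exists v => //=; lia.
- case/and3P => /eqP p1 /eqP b1 /eqP b2.
  pose s := [:: (b, v c + v d); (b', v c + v d)].
  have [us out] : uniq (unzip1 s) /\ {in [:: a; c; d; p], forall z, z \notin unzip1 s}.
    by apply: uniq_split uc _; solve_perm.
  exists (override v s); first by apply: (@update_of_override _ _ _ [::] [:: a; c; d; p]); solve_perm.
  have [oa oc od op] : [/\ override v s a = v a, override v s c = v c,
      override v s d = v d & override v s p = v p] by split; solve_out out.
  have [i1 i2] : override v s b = v c + v d /\ override v s b' = v c + v d by split; solve_in.
  by move: (override v s) oa oc od op i1 i2 => v' /= *; lia.
- move=> /eqP e.
  (* The coweakened branch carries 0, neutral for the sum at [p]. *)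
  pose s := [:: (p, v x); (a, v x); (b, 0); (b', 0)].
  have [us out] : uniq (unzip1 s) /\ {in [:: x; y], forall z, z \notin unzip1 s}.
    by apply: uniq_split uw _; solve_perm.
  exists (override v s); first by apply: (@update_of_override _ _ _ [:: x; y] [::]); solve_perm.
  have [ox oy] : override v s x = v x /\ override v s y = v y by split; solve_out out.
  have [i1 i2 i3 i4] : [/\ override v s p = v x, override v s a = v x,
      override v s b = 0 & override v s b' = 0] by split; solve_in.
  by move: (override v s) ox oy i1 i2 i3 i4 => v' /= *; lia.
Qed.

(** * Free ports under rules and renamings *)

Definition free_in (S : seq component) (p : port) : bool :=
  (p \in wire_sources S) && (p \notin cell_ports S).

Definition free_out (S : seq component) (p : port) : bool :=
  (p \in wire_ends S) && (p \notin cell_ports S).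

(* A redex and its reduct (likewise the two sides of a structural rule) only differ by the
   internal ports [t1, t2] and [t1', t2'], which are attached to both a wire and a cell. *)
Lemma rule_interface {l r} : reduction_rule l r \/ structural_rule l r ->
  exists w1 w2 u t1 t2 t1' t2',
  [/\ perm_eq (wire_sources l) (t1 ++ w1), perm_eq (wire_ends l) (t2 ++ w2) &
      perm_eq (cell_ports l) (t1 ++ t2 ++ u)] /\
  [/\ perm_eq (wire_sources r) (t1' ++ w1), perm_eq (wire_ends r) (t2' ++ w2) &
      perm_eq (cell_ports r) (t1' ++ t2' ++ u)].
Proof.
case=> [[q a b p c d ac ca ad da bc cb bd db|q p c d|q a b p|q p]
  |[p a b|p a b b' c d|x p a b b' y|p a b|p a b b' c d|x p a b b' y]].
- exists [::], [::], [:: a; b; c; d], [:: q], [:: p], [:: ac; ad; bc; bd], [:: ca; da; cb; db].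
  by split; split; solve_perm.
- exists [::], [::], [:: c; d], [:: q], [:: p], [::], [::]; by split; split; solve_perm.
- exists [::], [::], [:: a; b], [:: q], [:: p], [::], [::]; by split; split; solve_perm.
- exists [::], [::], [::], [:: q], [:: p], [::], [::]; by split; split; solve_perm.
- exists [::], [::], [:: p; a; b], [::], [::], [::], [::]; by split; split; solve_perm.
- exists [::], [::], [:: p; a; c; d], [:: b], [:: b'], [:: b], [:: b'].
  by split; split; solve_perm.
- exists [:: x], [:: y], [::], [:: a; b], [:: p; b'], [::], [::]; by split; split; solve_perm.
- exists [::], [::], [:: p; a; b], [::], [::], [::], [::]; by split; split; solve_perm.
- exists [::], [::], [:: p; a; c; d], [:: b'], [:: b], [:: b'], [:: b].
  by split; split; solve_perm.
- exists [:: x], [:: y], [::], [:: p; b'], [:: a; b], [::], [::]; by split; split; solve_perm.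
Qed.

(** The ports [t1] and [t2] drop out, being attached to cells and listed only once among the wire
    ports. What remains involves only [w1], [w2], [u] and the context, which both sides of a rule
    share. *)
Lemma free_interface {l ctx S : seq component} {t1 t2 w1 w2 u} (p : port) :
  perm_eq S (l ++ ctx) -> well_formed S ->
  perm_eq (wire_sources l) (t1 ++ w1) -> perm_eq (wire_ends l) (t2 ++ w2) ->
  perm_eq (cell_ports l) (t1 ++ t2 ++ u) ->
  free_in S p = (p \in w1 ++ wire_sources ctx) && (p \notin u ++ cell_ports ctx) /\
  free_out S p = (p \in w2 ++ wire_ends ctx) && (p \notin u ++ cell_ports ctx).
Proof.
move=> e wS e1 e2 ec.
have eS : wire_sources S =i t1 ++ (w1 ++ wire_sources ctx).
  move=> z; rewrite (perm_mem (perm_flatten_map _ e)) -/(wire_sources _) wire_sources_cat.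
  by rewrite !mem_cat (perm_mem e1) mem_cat orbA.
have eE : wire_ends S =i t2 ++ (w2 ++ wire_ends ctx).
  move=> z; rewrite (perm_mem (perm_flatten_map _ e)) -/(wire_ends _) wire_ends_cat.
  by rewrite !mem_cat (perm_mem e2) mem_cat orbA.
have eC : cell_ports S =i t1 ++ t2 ++ (u ++ cell_ports ctx).
  move=> z; rewrite (perm_mem (perm_cell_ports e)) mem_cell_ports_cat (perm_mem ec).
  by rewrite !mem_cat !orbA.
have u1 : uniq (t1 ++ (w1 ++ wire_sources ctx)).
  case/and4P: wS => h0 _ _ _.
  move: h0; rewrite (perm_uniq (perm_wire_ports e)) [uniq (wire_ports _)]cat_uniq => /and3P[h _ _].
  have pe : perm_eq (wire_sources l ++ wire_sources ctx) ((t1 ++ w1) ++ wire_sources ctx).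
    by rewrite perm_cat2r.
  by rewrite catA -(perm_uniq pe) -wire_sources_cat.
have u2 : uniq (t2 ++ (w2 ++ wire_ends ctx)).
  case/and4P: wS => h0 _ _ _.
  move: h0; rewrite (perm_uniq (perm_wire_ports e)) [uniq (wire_ports _)]cat_uniq => /and3P[_ _ h].
  have pe : perm_eq (wire_ends l ++ wire_ends ctx) ((t2 ++ w2) ++ wire_ends ctx).
    by rewrite perm_cat2r.
  by rewrite catA -(perm_uniq pe) -wire_ends_cat.
have dis z : z \in t1 ++ (w1 ++ wire_sources ctx) -> z \in t2 ++ (w2 ++ wire_ends ctx) -> false.
  by rewrite -eS -eE => /(source_not_end wS) ->.
have d1 z : z \in t1 -> z \in w1 ++ wire_sources ctx -> false.
  by move: u1; rewrite cat_uniq => /and3P[_ /hasPn h _] zt /h; rewrite /= zt.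
have d2 z : z \in t2 -> z \in w2 ++ wire_ends ctx -> false.
  by move: u2; rewrite cat_uniq => /and3P[_ /hasPn h _] zt /h; rewrite /= zt.
split; rewrite /free_in /free_out eC.
  rewrite eS ![p \in t1 ++ _]mem_cat [p \in t2 ++ _]mem_cat.
  case p1: (p \in t1) => /=; first by case p2: (p \in _ ++ _) => //; have := d1 _ p1 p2.
  case p2: (p \in t2) => //=; rewrite andbF.
  case p3: (p \in _ ++ _) => //.
  by have := dis p; rewrite ![p \in _ ++ (_ ++ _)]mem_cat p2 p3 orbT /= => /(_ isT isT).
rewrite eE [p \in t1 ++ _]mem_cat ![p \in t2 ++ _]mem_cat.
case p2: (p \in t2) => /=.
  by rewrite orbT; case p3: (p \in _ ++ _) => //; have := d2 _ p2 p3.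
case p1: (p \in t1) => //=; rewrite andbF.
case p3: (p \in _ ++ _) => //.
by have := dis p; rewrite ![p \in _ ++ (_ ++ _)]mem_cat p1 p3 orbT /= => /(_ isT isT).
Qed.

Definition same_interface (S S' : seq component) : Prop :=
  free_in S =1 free_in S' /\ free_out S =1 free_out S'.

Lemma rule_same_interface {l r ctx} {S S' : net} : reduction_rule l r \/ structural_rule l r ->
  perm_eq S (l ++ ctx) -> perm_eq S' (r ++ ctx) -> same_interface S S'.
Proof.
case/rule_interface=> [w1 [w2 [u [t1 [t2 [t1' [t2' [[a1 a2 a3] [b1 b2 b3]]]]]]]]] e e'.
by split=> p; have [i o] := free_interface p e (net_well_formed S) a1 a2 a3;
   have [i' o'] := free_interface p e' (net_well_formed S') b1 b2 b3; rewrite ?i ?o ?i' ?o'.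
Qed.

Lemma wire_sources_rename f S : wire_sources (map (rename f) S) = map f (wire_sources S).
Proof.
rewrite /wire_sources map_flatten -!map_comp; congr flatten.
by apply: eq_map => -[].
Qed.

Lemma wire_ends_rename f S : wire_ends (map (rename f) S) = map f (wire_ends S).
Proof.
rewrite /wire_ends map_flatten -!map_comp; congr flatten.
by apply: eq_map => -[].
Qed.

Lemma cell_ports_rename f S : cell_ports (map (rename f) S) = map f (cell_ports S).
Proof.
rewrite /cell_ports /cell_sources /cell_ends map_cat !map_flatten -!map_comp.
by congr (_ ++ _); congr flatten; apply: eq_map => -[].
Qed.

(** Injectivity and the fixed free ports prevent a bound port from taking the name of a free one. *)
Lemma renaming_same_interface {S S' : net} : renaming S S' -> same_interface S S'.
Proof.
case=> f [inj fix_f e].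
have wc : cell_ports S' =i map f (cell_ports S).
  by move=> p; rewrite (perm_mem (perm_cell_ports e)) cell_ports_rename.
have key (A : seq port) p : {subset A <= wire_ports S} ->
  (p \in A) && (p \notin cell_ports S) = (p \in map f A) && (p \notin map f (cell_ports S)).
  move=> sub; apply/andP/andP => -[].
    move=> pA pc; have fp := fix_f _ (sub _ pA) pc.
    split; first by rewrite -fp map_f.
    apply/mapP => -[q qc pq]; case/negP: pc.
    suff -> : p = q by [].
    apply: inj; [exact: sub|exact: cell_portW (net_well_formed S) qc|by rewrite fp].
  case/mapP=> q qA -> fq.
  have qc : q \notin cell_ports S by apply: contra fq => /(map_f f).
  by rewrite fix_f ?sub.
split=> p; rewrite /free_in /free_out wc.
  rewrite (perm_mem (perm_flatten_map _ e)) -/(wire_sources _) wire_sources_rename.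
  by apply: key => q qs; rewrite mem_cat qs.
rewrite (perm_mem (perm_flatten_map _ e)) -/(wire_ends _) wire_ends_rename.
by apply: key => q qs; rewrite mem_cat qs orbT.
Qed.

(** * Conservation of solutions along equivalence and reduction *)

(** An oriented relation: a reduction step only has to push solutions forward. Equality of the
    interfaces is included so that the relation composes. *)
Definition conserves (S S' : net) : Prop :=
  same_interface S S' /\
  forall v, all (flow 0 v) S -> exists2 v', all (flow 0 v') S' &
    forall p, free_in S p || free_out S p -> v' p = v p.

Lemma conserves_refl S : conserves S S.
Proof. by split=> // v h; exists v. Qed.

Lemma conserves_trans S1 S2 S3 : conserves S1 S2 -> conserves S2 S3 -> conserves S1 S3.
Proof.
move=> [[i1 o1] h1] [[i2 o2] h2]; split; first by split=> p; rewrite ?i1 ?o1.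
move=> v /h1[v1 /h2[v2 f2 e2] e1]; exists v2 => // p fp.
by rewrite e2 ?e1 // -i1 -o1.
Qed.

Lemma conserves_update {l r ctx} {S S' : net} : same_interface S S' ->
  perm_eq S (l ++ ctx) -> perm_eq S' (r ++ ctx) ->
  (forall v, all (flow 0 v) l -> exists2 v', update_of r v v' & all (flow 0 v') r) ->
  conserves S S'.
Proof.
move=> si e e' h; split=> // v; rewrite (perm_all _ e) => fl.
have := fl; rewrite all_cat => /andP[/h[v' u fr] _].
have w : well_formed (r ++ ctx) by rewrite -(perm_well_formed e') net_well_formed.
exists v' => [|p]; first by rewrite (perm_all _ e'); exact: all_update (local_flow 0) w u fl fr.
(* A free port is on no cell, hence is not internal to [r]. *)
rewrite si.1 si.2 => fp; apply: u; rewrite negb_and; apply/orP; right.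
have : p \notin cell_ports S' by case/orP: fp => /andP[].
by apply: contra => pr; rewrite (perm_mem (perm_cell_ports e')) mem_cell_ports_cat pr.
Qed.

Lemma uniq_rule_ports {r ctx} {S : net} : perm_eq S (r ++ ctx) ->
  uniq (wire_ports r) /\ uniq (cell_ports r).
Proof.
move=> e; have := net_well_formed S; rewrite (perm_well_formed e) => /and4P[uw uc _ _].
move: uw uc; rewrite (perm_uniq (perm_wire_ports_cat _ _)) (perm_uniq (perm_cell_ports_cat _ _)).
by rewrite !cat_uniq => /and3P[-> _ _] /and3P[-> _ _].
Qed.

Lemma conserves_step {S S'} : step S S' -> conserves S S'.
Proof.
case=> l [r [ctx [rule e e']]]; have [uw uc] := uniq_rule_ports e'.
apply: conserves_update (rule_same_interface (or_introl rule) e e') e e' _.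
by move=> v /(flow_reduction 0 v rule uw uc)[v' [? ? _]]; exists v'.
Qed.

Lemma same_interface_sym {S S'} : same_interface S S' -> same_interface S' S.
Proof. by case=> i o; split=> p; rewrite ?i ?o. Qed.

Lemma conserves_structural {S S'} : in_context structural_rule S S' ->
  conserves S S' /\ conserves S' S.
Proof.
case=> l [r [ctx [rule e e']]].
have si := rule_same_interface (or_intror rule) e e'.
split.
  have [_ uc] := uniq_rule_ports e'; apply: conserves_update si e e' _ => v.
  exact: flow_structural.
have [uw uc] := uniq_rule_ports e.
apply: conserves_update (same_interface_sym si) e' e _ => v.
exact: flow_structural_sym.
Qed.

Lemma all_flow_rename f v S : all (flow 0 v) (map (rename f) S) = all (flow 0 (v \o f)) S.
Proof. by rewrite all_map; apply: eq_all => -[]. Qed.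

Lemma eq_all_flow {S : net} {v v'} : {in wire_ports S, v =1 v'} ->
  all (flow 0 v) S = all (flow 0 v') S.
Proof.
move=> h; apply: eq_in_all => c cS; apply: local_flow => p pc.
by apply/h/(mem_ports_ofW (net_well_formed S) cS pc).
Qed.

Lemma free_port {S p} : free_in S p || free_out S p -> p \in wire_ports S.
Proof. by rewrite mem_cat => /orP[/andP[->]|/andP[->]]; rewrite ?orbT. Qed.

Lemma conserves_renaming {S S'} : renaming S S' -> conserves S S' /\ conserves S' S.
Proof.
move=> ren; have si := renaming_same_interface ren.
case: ren => f [inj fix_f e].
have fixF p : free_in S p || free_out S p -> f p = p.
  by move=> fp; apply: fix_f; [exact: free_port fp|case/orP: fp => /andP[]].
split; split=> //; last first.
  - move=> v; rewrite (perm_all _ e) all_flow_rename => fv; exists (v \o f) => // p.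
    by rewrite -si.1 -si.2 => /fixF /= ->.
  - exact: same_interface_sym.
(* [g] inverts [f] on the ports of [S], by position in the list of ports. *)
move=> v fv; pose g p := nth 0 (wire_ports S) (index p (map f (wire_ports S))).
have fK : {in wire_ports S, cancel f g}.
  move=> p pS; rewrite /g.
  have -> : index (f p) (map f (wire_ports S)) = index p (wire_ports S).
    elim: (wire_ports S) inj pS => //= q s ih inj; rewrite inE => ps.
    have -> : (f q == f p) = (q == p).
      by apply/eqP/eqP => [/inj->|->] //; rewrite inE ?eqxx.
    case: eqP => [//|/eqP qp]; congr _.+1; apply: ih.
      by move=> a b aS bS; apply: inj; rewrite inE ?aS ?bS orbT.
    by case/orP: ps => // /eqP pq; rewrite pq eqxx in qp.
  by rewrite nth_index.
exists (v \o g) => [|p fp /=].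
  rewrite (perm_all _ e) all_flow_rename -(@eq_all_flow _ v) // => p pS /=.
  by rewrite fK.
by rewrite -[in g p](fixF _ fp) fK // free_port.
Qed.

(** Both directions are carried along because the equivalence is closed under symmetry. *)
Lemma conserves_equiv {S S'} : Defs.equiv S S' -> conserves S S' /\ conserves S' S.
Proof.
elim=> {S S'} [S S' [/conserves_renaming|/conserves_structural] //|S|S S' _ []//|].
- by split; exact: conserves_refl.
- by move=> S1 S2 S3 _ [a b] _ [c d]; split; [apply: conserves_trans a c|apply: conserves_trans d b].
Qed.

Lemma conserves_reduces {S S'} : reduces S S' -> conserves S S'.
Proof.
elim=> {S S'} [S S' [/conserves_equiv[]|/conserves_step] //|S|S1 S2 S3 _ a _ b].
- exact: conserves_refl.
- exact: conserves_trans a b.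
Qed.

(** * Oriented edges *)

(* [(x, e, y)]: the edge [e] traversed from [x] to [y], following the orientation of wires. *)
Definition oriented_edge := (port * edge * port)%type.

Definition arcs_of (c : component) : seq oriented_edge :=
  match c with
  | Wire s e => [:: (s, inl (s, e), e)]
  | Contr p a b => [:: (p, inr (a, p), a); (p, inr (b, p), b)]
  | Cocontr p a b => [:: (a, inr (a, p), p); (b, inr (b, p), p)]
  | _ => [::]
  end.

Definition arcs (S : seq component) : seq oriented_edge := flatten (map arcs_of S).

Lemma mem_wire_source {S s e} : Wire s e \in S -> s \in wire_sources S.
Proof. by move=> cS; apply/flatten_mapP; exists (Wire s e); rewrite ?inE. Qed.

Lemma mem_wire_end {S s e} : Wire s e \in S -> e \in wire_ends S.
Proof. by move=> cS; apply/flatten_mapP; exists (Wire s e); rewrite ?inE. Qed.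

Lemma mem_contr {S p a b} : Contr p a b \in S ->
  [/\ p \in cell_ends S, a \in cell_sources S & b \in cell_sources S].
Proof. by move=> cS; split; apply/flatten_mapP; exists (Contr p a b); rewrite // !inE eqxx ?orbT. Qed.

Lemma mem_cocontr {S p a b} : Cocontr p a b \in S ->
  [/\ p \in cell_sources S, a \in cell_ends S & b \in cell_ends S].
Proof. by move=> cS; split; apply/flatten_mapP; exists (Cocontr p a b); rewrite // !inE eqxx ?orbT. Qed.

Lemma mem_weak {S p} : Weak p \in S -> p \in cell_ends S.
Proof. by move=> cS; apply/flatten_mapP; exists (Weak p); rewrite ?inE. Qed.

Lemma mem_coweak {S p} : Coweak p \in S -> p \in cell_sources S.
Proof. by move=> cS; apply/flatten_mapP; exists (Coweak p); rewrite ?inE. Qed.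

(** Wires lead from sources to ends and cells from ends back to sources; this is what ties
    alternation to orientation. *)
Lemma arc_kind {S d} : well_formed S -> d \in arcs S ->
  if is_wire_edge d.1.2 then (d.1.1 \in wire_sources S) && (d.2 \in wire_ends S)
  else (d.1.1 \in cell_ends S) && (d.2 \in cell_sources S).
Proof.
move=> wS /flatten_mapP[[s e|p a b|p a b|p|p] cS //=]; rewrite !inE.
- by move=> /eqP -> /=; rewrite (mem_wire_source cS) (mem_wire_end cS).
- by have [p1 a1 b1] := mem_contr cS; case/orP=> /eqP -> /=; rewrite ?p1 ?a1 ?b1.
- by have [p1 a1 b1] := mem_cocontr cS; case/orP=> /eqP -> /=; rewrite ?p1 ?a1 ?b1.
Qed.

Lemma arc_edge {S y e x} : (y, e, x) \in arcs S -> e \in edges S /\ links e y x.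
Proof.
case/flatten_mapP=> [[s f|p a b|p a b|p|p] cS //=]; rewrite !inE /edges mem_cat.
- move=> /eqP[-> -> ->]; rewrite /links eqxx; split=> //; apply/orP; left.
  by apply/flatten_mapP; exists (Wire s f); rewrite ?inE.
- case/orP=> /eqP[-> -> ->]; rewrite /links eqxx orbT; split=> //; apply/orP; right;
  by apply/flatten_mapP; exists (Contr p a b); rewrite ?inE ?eqxx ?orbT.
- case/orP=> /eqP[-> -> ->]; rewrite /links eqxx; split=> //; apply/orP; right;
  by apply/flatten_mapP; exists (Cocontr p a b); rewrite ?inE ?eqxx ?orbT.
Qed.

Lemma edge_arc {S y e x} : e \in edges S -> links e y x ->
  (y, e, x) \in arcs S \/ (x, e, y) \in arcs S.
Proof.
rewrite /edges mem_cat => /orP[] /flatten_mapP[[s f|p a b|p a b|p|p] cS //=]; rewrite !inE.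
- by move=> /eqP -> /orP[] /eqP[<- <-]; [left|right]; apply/flatten_mapP; exists (Wire s f);
    rewrite ?inE.
- by case/orP=> /eqP -> /orP[] /eqP[<- <-]; [right|left|right|left]; apply/flatten_mapP;
    exists (Contr p a b); rewrite ?inE ?eqxx ?orbT.
- by case/orP=> /eqP -> /orP[] /eqP[<- <-]; [left|right|left|right]; apply/flatten_mapP;
    exists (Cocontr p a b); rewrite ?inE ?eqxx ?orbT.
Qed.

Lemma uniq_flatten_map_inj {I T : eqType} {f : I -> seq T} {S : seq I} {c c' : I} {x} :
  uniq (flatten (map f S)) -> c \in S -> c' \in S -> x \in f c -> x \in f c' -> c = c'.
Proof.
elim: S => //= b S ih; rewrite cat_uniq => /and3P[_ /hasPn h u].
rewrite !inE => /orP[/eqP ->|cS] /orP[/eqP ->|cS'] // xc xc'; last exact: ih.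
  have /h : x \in flatten (map f S) by apply/flatten_mapP; exists c'.
  by rewrite /= xc.
have /h : x \in flatten (map f S) by apply/flatten_mapP; exists c.
by rewrite /= xc'.
Qed.

Lemma uniq_flatten_map_sub {I T : eqType} {f : I -> seq T} {S : seq I} {c : I} :
  uniq (flatten (map f S)) -> c \in S -> uniq (f c).
Proof.
elim: S => //= b S ih; rewrite cat_uniq => /and3P[u _ us].
by rewrite inE => /orP[/eqP ->|/(ih us)].
Qed.

Lemma uniq_cell_sources {S} : well_formed S -> uniq (cell_sources S).
Proof. by case/and4P=> _; rewrite cat_uniq => /and3P[]. Qed.

Lemma uniq_cell_ends {S} : well_formed S -> uniq (cell_ends S).
Proof. by case/and4P=> _; rewrite cat_uniq => /and3P[]. Qed.

Lemma uniq_wire_sources {S} : well_formed S -> uniq (wire_sources S).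
Proof. by case/and4P; rewrite cat_uniq => /and3P[]. Qed.

Lemma uniq_wire_ends {S} : well_formed S -> uniq (wire_ends S).
Proof. by case/and4P; rewrite cat_uniq => /and3P[]. Qed.

(** ** Correctness and directed cycles *)

Definition arc_rel (S : seq component) : rel port :=
  fun x y => has (fun d : oriented_edge => (d.1.1 == x) && (d.2 == y)) (arcs S).

(** [tgt] assigns to an edge its head, so that distinct ports along a directed path entail distinct
    edges, as [is_cycle] demands. *)
Lemma path_walk (E : seq edge) (tgt : edge -> port) x p :
  path (fun x y => has (fun z => links z x y && (tgt z == y)) E) x p ->
  exists st, [/\ walk E x st, unzip2 st = p & map tgt (unzip1 st) = p].
Proof.
elim: p x => [|y p ih] x /=; first by exists [::].
case/andP=> /hasP[z zE /andP[lz /eqP tz]] /ih[st [w e1 e2]].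
by exists ((z, y) :: st); rewrite /= zE lz w e1 e2 tz.
Qed.

(* A simple directed cycle uses at most one auxiliary port of each contraction: it survives in
   the switching that selects, at each contraction on the cycle, the port followed by it. *)
Lemma correct_no_cycle {S : net} {c : seq port} :
  correct S -> uniq c -> cycle (arc_rel S) c -> c = [::].
Proof.
move=> corr uc cyc; have wS := net_well_formed S.
pose sw p := has (fun c0 => if c0 is Contr q a _ then (q == p) && (next c p == a) else false) S.
pose E := wire_edges S ++ switched_cell_edges sw S.
(* The head of a cell edge is the auxiliary port in a contraction, where that port is a cell source,
   and the principal port in a cocontraction. *)
pose tgt (z : edge) := match z with
  | inl w => w.2
  | inr w => if w.1 \in cell_sources S then w.1 else w.2 end.
have : cycle (fun x y => has (fun z => links z x y && (tgt z == y)) E) c.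
  apply: cycle_from_next => // x xc.
  have /hasP[d /flatten_mapP[k kS dk] /andP[/eqP dx /eqP dn]] := next_cycle cyc xc.
  move: dn; case: k kS dk => [s e|p a b|p a b|p|p] kS //=; rewrite !inE.
  - move=> /eqP dE; rewrite dE /= in dx *; move=> <-; rewrite -dx.
    apply/hasP; exists (inl (s, e)); last by rewrite /links !eqxx.
    by rewrite mem_cat; apply/orP; left; apply/flatten_mapP; exists (Wire s e); rewrite ?inE.
  - have [_ a1 b1] := mem_contr kS.
    case/orP=> /eqP dE; rewrite dE /= in dx *; move=> dn; rewrite -dn -dx.
      apply/hasP; exists (inr (a, p)); last by rewrite /links /= a1 !eqxx orbT.
      rewrite mem_cat; apply/orP; right; apply/flatten_mapP; exists (Contr p a b) => //.
      have -> : sw p by apply/hasP; exists (Contr p a b); rewrite // eqxx dx dn eqxx.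
      by rewrite inE.
    apply/hasP; exists (inr (b, p)); last by rewrite /links /= b1 !eqxx orbT.
    rewrite mem_cat; apply/orP; right; apply/flatten_mapP; exists (Contr p a b) => //.
    (* If the switching chose the first port at [p], the contraction responsible would be the
       present one, by uniqueness of cell ends, and [a] and [b] would coincide. *)
    suff /negbTE -> : ~~ sw p by rewrite inE.
    apply/hasPn => -[] // q a' b' k'S; apply/negP => /andP[/eqP qp /eqP].
    rewrite dx -dn => a'E; subst q.
    have [p2 a2 b2] := mem_contr k'S.
    have := uniq_flatten_map_inj (uniq_cell_ends wS) kS k'S (mem_head p _) (mem_head p _).
    case=> aE _; have := uniq_flatten_map_sub (uniq_cell_sources wS) kS.
    by rewrite /= aE -a'E inE eqxx.
  - have [_ a1 b1] := mem_cocontr kS.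
    have ne z : z \in cell_ends S -> (z \in cell_sources S) = false.
      move=> /(cell_endW wS) ze; apply/negP => /(cell_sourceW wS)/(source_not_end wS).
      by rewrite ze.
    case/orP=> /eqP dE; rewrite dE /= in dx *; move=> dn; rewrite -dn -dx.
      apply/hasP; exists (inr (a, p)); last by rewrite /links /= ne ?eqxx.
      rewrite mem_cat; apply/orP; right; apply/flatten_mapP; exists (Cocontr p a b) => //.
      by rewrite inE eqxx.
    apply/hasP; exists (inr (b, p)); last by rewrite /links /= ne ?eqxx.
    rewrite mem_cat; apply/orP; right; apply/flatten_mapP; exists (Cocontr p a b) => //.
    by rewrite !inE eqxx orbT.
case: c uc @sw @E {cyc} => // x p uc sw E /path_walk[st [w e1 e2]].
have ux : uniq (rcons p x) by rewrite rcons_uniq.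
case/negP: (corr sw (x, st)); apply/and5P; split => //=.
- by case: (st) e1 => //; case: (p).
- by rewrite /trail_stop /trail_start /= e1 last_rcons.
- by apply: (@map_uniq _ _ tgt); rewrite e2.
- by rewrite e1.
Qed.

Lemma correct_ranked {S : net} : correct S -> exists h : port -> nat,
  {in arcs S, forall d, h d.1.1 < h d.2}.
Proof.
(* All ports met by arcs are below [n], which places reachability on the finite type ['I_n]. *)
move=> corr; pose n := (\max_(d <- arcs S) maxn d.1.1 d.2).+1.
have ltn d : d \in arcs S -> (d.1.1 < n) && (d.2 < n).
  move=> dS; have : maxn d.1.1 d.2 < n by rewrite ltnS; apply: leq_bigmax_seq dS _.
  by rewrite gtn_max.
pose e : rel 'I_n := fun x y => arc_rel S x y.
(* A path back from [y] to [x], once shortened, closes into a simple directed cycle. *)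
have acyc x y : e x y -> ~~ connect e y x.
  move=> exy; apply/negP => /connectP[p pp xE].
  move: exy; rewrite {x}xE; case/shortenP: pp => q qq uq _ eq.
  suff /(correct_no_cycle corr) : uniq (map val (y :: q)).
    suff cq : cycle (arc_rel S) (map val (y :: q)) by move=> /(_ cq).
    have : cycle e (y :: q) by rewrite /= rcons_path qq.
    by rewrite /= -map_rcons path_map.
  by rewrite map_inj_uniq //; exact: val_inj.
(* The rank counts the ports from which [z] is reachable; along an arc it gains at least the head.
   The value 0 is a default for names from [n] on, which occur on no arc. *)
pose h (z : nat) := if insub z is Some i then #|[pred y : 'I_n | connect e y i]| else 0.
exists h => d dS; have /andP[d1 d2] := ltn d dS.
rewrite /h !insubT /=; set i := Sub _ _; set j := Sub _ _.
have eij : e i j by apply/hasP; exists d; rewrite // !SubK !eqxx.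
apply: proper_card; apply/properP; split.
  apply/fintype.subsetP => y; rewrite !inE => /connect_trans; apply; exact: connect1.
by exists j; rewrite !inE ?connect0 //; exact: acyc.
Qed.

Lemma ranked_increasing {S h} : {in arcs S, forall d, h d.1.1 < h d.2} -> all (increasing h) S.
Proof.
move=> rk; have arcS c d : c \in S -> d \in arcs_of c -> h d.1.1 < h d.2.
  by move=> cS dc; apply: rk; apply/flatten_mapP; exists c.
apply/allP => -[s e|p a b|p a b|p|p] // cS.
- by apply: (arcS _ (s, inl (s, e), e) cS); rewrite inE.
- by rewrite /= (arcS _ (p, inr (a, p), a) cS) ?(arcS _ (p, inr (b, p), b) cS) ?inE ?eqxx ?orbT.
- by rewrite /= (arcS _ (a, inr (a, p), p) cS) ?(arcS _ (b, inr (b, p), p) cS) ?inE ?eqxx ?orbT.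
Qed.

(** ** Equations along the arcs of a ranked net *)

(** The value at [x] depends only on ports of lower rank, so iteration from [t0] is stable at [x]
    after [h x + 1] rounds. [T] is general in order to solve for numbers and for lists of paths. *)
Lemma ranked_fixpoint {T : Type} (t0 : T) {A : seq oriented_edge} {h : port -> nat}
    (G : port -> seq (oriented_edge * T) -> T) :
  {in A, forall d, h d.1.1 < h d.2} ->
  exists v : port -> T, forall x, v x = G x [seq (d, v d.1.1) | d <- A & d.2 == x].
Proof.
move=> rk; pose F (v : port -> T) x := G x [seq (d, v d.1.1) | d <- A & d.2 == x].
pose w n := iter n F (fun=> t0).
have stable n m x : h x < n -> h x < m -> w n x = w m x.
  elim: n m x => // n ih [//|m] x; rewrite !ltnS => xn xm.
  rewrite /w /= /F; congr G; apply/eq_in_map => d; rewrite mem_filter => /andP[/eqP dx dA].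
  have := rk _ dA; rewrite dx => lt.
  by rewrite -/(w n _) (ih m) //; apply: leq_trans lt _.
exists (fun x => w (h x).+1 x) => x.
have -> : w (h x).+1 x = F (w (h x)) x by [].
rewrite /F; congr G; apply/eq_in_map => d; rewrite mem_filter => /andP[/eqP dx dA].
by congr (_, _); apply: stable; rewrite // -dx; apply: rk.
Qed.

Definition incoming (S : seq component) (v : port -> nat) (x : port) : nat :=
  sumn [seq v d.1.1 | d <- arcs S & d.2 == x].

(** The ports whose labels the component dictates in [flow]. Besides the heads of [arcs_of], they
    include the port of a coweakening. *)
Definition outs (c : component) : seq port :=
  (if c is Wire _ e then [:: e] else [::]) ++
  match c with
  | Contr _ a b => [:: a; b]
  | Cocontr p _ _ => [:: p]
  | Coweak p => [:: p]
  | _ => [::]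
  end.

Lemma perm_flatten_map_cat {T : eqType} (f g : component -> seq T) S :
  perm_eq (flatten [seq f c ++ g c | c <- S]) (flatten (map f S) ++ flatten (map g S)).
Proof.
by elim: S => //= c S ih; rewrite perm_sym perm_catACA perm_sym perm_cat2l.
Qed.

Lemma uniq_outs {S} : well_formed S -> uniq (flatten (map outs S)).
Proof.
move=> wS; rewrite (perm_uniq (perm_flatten_map_cat _ _ S)) cat_uniq.
rewrite (uniq_wire_ends wS) (uniq_cell_sources wS) andbT; apply/hasPn => x /(cell_sourceW wS) xs.
by rewrite /= (source_not_end wS xs).
Qed.

Lemma arcs_of_outs {c d} : d \in arcs_of c -> d.2 \in outs c.
Proof.
by case: c => [s e|p a b|p a b|p|p] //; rewrite !inE; do ?case/orP; move=> /eqP -> /=;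
  rewrite ?inE eqxx ?orbT.
Qed.

(** No two components share a port of [outs], so every arc into [x] comes from [c]. *)
Lemma incoming_outs {S c} v {x} : well_formed S -> c \in S -> x \in outs c ->
  incoming S v x = sumn [seq v d.1.1 | d <- arcs_of c & d.2 == x].
Proof.
move=> wS cS xc; rewrite /incoming.
have e := perm_to_rem cS.
rewrite (perm_sumn (perm_map _ (perm_filter _ (perm_flatten_map arcs_of e)))) /=.
rewrite filter_cat map_cat sumn_cat.
have : uniq (flatten (map outs (c :: rem c S))) by rewrite -(perm_uniq (perm_flatten_map _ e)) uniq_outs.
rewrite /= cat_uniq => /and3P[_ /hasPn dis _].
suff -> : [seq d <- flatten (map arcs_of (rem c S)) | d.2 == x] = [::] by rewrite addn0.
apply/eqP; rewrite -[_ == _]negbK -has_filter; apply/hasPn => d /flatten_mapP[c' c'S dc'].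
apply/eqP => dx; have : x \in flatten (map outs (rem c S)).
  by apply/flatten_mapP; exists c' => //; rewrite -dx; exact: arcs_of_outs.
by move/dis; rewrite /= xc.
Qed.

Lemma incoming_free_in {S v x} : well_formed S -> free_in S x -> incoming S v x = 0.
Proof.
move=> wS /andP[xs xc]; rewrite /incoming.
suff -> : [seq d <- arcs S | d.2 == x] = [::] by [].
apply/eqP; rewrite -[_ == _]negbK -has_filter; apply/hasPn => d /(arc_kind wS).
case: ifP => _ /andP[_ d2]; apply/eqP => dx; rewrite dx in d2.
  by rewrite (source_not_end wS xs) in d2.
by case/negP: xc; rewrite mem_cat d2.
Qed.

(** Passes from one equation per port to one condition per component. The source term [g] is
    prescribed on the ports governed by a component and left free at the inputs. *)
Lemma flow_of_equation {S k g v} : well_formed S -> (forall x, v x = g x + incoming S v x) ->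
  {in S, forall c, match c with
     | Wire _ e => g e = 0 | Contr _ a b => g a = 0 /\ g b = 0
     | Cocontr p _ _ | Coweak p => g p = k | Weak _ => True end} ->
  all (flow k v) S.
Proof.
move=> wS eqv hg; apply/allP => c cS; move: (hg c cS).
have inc x := @incoming_outs S c v x wS cS.
case: c cS inc => [s e|p a b|p a b|p|p] cS inc //=.
- by move=> ge; rewrite eqv ge inc ?inE //= eqxx /= addn0.
- have := uniq_flatten_map_sub (uniq_cell_sources wS) cS; rewrite /= inE andbT => ab.
  case=> ga gb; rewrite (eqv a) (eqv b) ga gb !inc ?inE ?eqxx ?orbT //=.
  have ba : (b == a) = false by rewrite eq_sym (negbTE ab).
  by rewrite ?eqxx ?ba ?(negbTE ab) /= ?ba ?eqxx /= !addn0 !eqxx.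
- by move=> gp; rewrite (eqv p) gp inc ?inE //= eqxx /= addn0 addnC.
- by move=> gp; rewrite (eqv p) gp inc ?inE //= addn0.
Qed.

(** The source term is the indicator of [cop], the principal ports of cocontractions and
    coweakenings. *)
Lemma potential_exists {S h} : well_formed S -> {in arcs S, forall d, h d.1.1 < h d.2} ->
  exists u, all (flow 1 u) S.
Proof.
move=> wS rk; pose cop := flatten [seq match c with
  | Cocontr p _ _ | Coweak p => [:: p] | _ => [::] end | c <- S].
have [v eqv] := ranked_fixpoint 0 (fun x L => (x \in cop) + sumn (unzip2 L)) rk.
have cop_cell x : x \in cop -> x \in cell_sources S.
  by case/flatten_mapP=> -[] // => [p a b|p] cS; rewrite inE => /eqP ->;
     [have [] := mem_cocontr cS | exact: mem_coweak cS].
have cop_contr p a b x : Contr p a b \in S -> x \in [:: a; b] -> x \notin cop.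
  move=> cS xab; apply/negP => /flatten_mapP[c' c'S xc'].
  have := uniq_flatten_map_inj (uniq_cell_sources wS) cS c'S xab.
  by case: c' c'S xc' => [s e|q a' b'|q a' b'|q|q] // _ xq /(_ xq).
exists v; apply: (@flow_of_equation S 1 (fun x => (x \in cop) : nat)) => // [x|].
  by rewrite eqv /incoming /unzip2 -map_comp.
case=> [s e|p a b|p a b|p|p] cS //.
- case: (boolP (e \in cop)) => // /cop_cell /(cell_sourceW wS)/(source_not_end wS).
  by rewrite (mem_wire_end cS).
- by rewrite !(negbTE (cop_contr _ _ _ _ cS _)) ?inE ?eqxx ?orbT.
- suff -> : p \in cop by []; by apply/flatten_mapP; exists (Cocontr p a b); rewrite ?inE.
- suff -> : p \in cop by []; by apply/flatten_mapP; exists (Coweak p); rewrite ?inE.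
Qed.

(** ** Paths *)

(* Following the orientation, wire edges and cell edges alternate automatically. *)
Fixpoint directed (S : seq component) (p : port) (st : seq (edge * port)) : bool :=
  if st is (e, q) :: st' then ((p, e, q) \in arcs S) && directed S q st' else true.

Lemma directed_rcons S p st e q :
  directed S p (rcons st (e, q)) =
  directed S p st && ((last p (unzip2 st), e, q) \in arcs S).
Proof. by elim: st p => [|[f r] st ih] p /=; rewrite ?andbT // ih andbA. Qed.

(** Once the first edge follows the orientation, so does the whole walk: a wire arrives at an end,
    from which a cell edge can only be taken along its arc, and dually. *)
Lemma walk_directed {S p st} : well_formed S ->
  (forall e q st', st = (e, q) :: st' ->
     p \in (if is_wire_edge e then wire_sources S else wire_ends S)) ->
  walk (edges S) p st -> sorted (fun x y => is_wire_edge x != is_wire_edge y) (unzip1 st) ->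
  directed S p st.
Proof.
move=> wS; elim: st p => //= -[e q] st ih p hp /and3P[eS lk w] srt.
have pe := hp e q st erefl.
have arc : (p, e, q) \in arcs S.
  case: (edge_arc eS lk) => // /(arc_kind wS) /=; move: pe.
  case: ifP => _ ps /andP[_ p2]; first by rewrite (source_not_end wS ps) in p2.
  by have := source_not_end wS (cell_sourceW wS p2); rewrite ps.
rewrite arc /=; apply: ih => //; last by exact: path_sorted srt.
move=> f r st' stE; move: srt; rewrite stE /= => /andP[ef _].
have := arc_kind wS arc => /=; case: (is_wire_edge e) ef => /=; case: (is_wire_edge f) => //= _ /andP[_].
  by [].
exact: cell_sourceW.
Qed.

(** Two consecutive arcs of the same nature would meet at a port that is both a source and an
    end. *)
Lemma directed_walk {S p st} : well_formed S -> directed S p st ->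
  walk (edges S) p st &&
  sorted (fun x y => is_wire_edge x != is_wire_edge y) (unzip1 st).
Proof.
move=> wS; elim: st p => //= -[e q] st ih p /andP[arc dir].
have [eS lk] := arc_edge arc; have /andP[w srt] := ih _ dir.
rewrite eS lk w /=; case: st dir srt {ih w} => //= -[f r] st /andP[arc' _] srt.
rewrite srt andbT; have := arc_kind wS arc; have := arc_kind wS arc'; rewrite /=.
case: (is_wire_edge e); case: (is_wire_edge f) => //= /andP[q1 _] /andP[_ q2].
  by have := source_not_end wS q1; rewrite q2.
by have := cell_endW wS q1; rewrite (source_not_end wS (cell_sourceW wS q2)).
Qed.

Lemma uniq_arcs {S} : well_formed S -> uniq (arcs S).
Proof.
move=> wS; have arcs_of_uniq : {in S, forall c, uniq (arcs_of c)}.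
  move=> [s e|p a b|p a b|p|p] cS //=; rewrite inE andbT; apply/eqP => -[ab]; subst b.
    by have := uniq_flatten_map_sub (uniq_cell_sources wS) cS; rewrite /= inE eqxx.
  by have := uniq_flatten_map_sub (uniq_cell_ends wS) cS; rewrite /= inE eqxx.
rewrite /arcs; move: arcs_of_uniq (uniq_outs wS) => {wS}; elim: S => //= c r ih u.
rewrite !cat_uniq => /and3P[_ /hasPn dis /ih ur].
rewrite u ?mem_head //= ur ?andbT; last by move=> c' c'r; rewrite u // inE c'r orbT.
apply/hasPn => d /flatten_mapP[c' c'r dc']; apply/negP => dc.
have : d.2 \in flatten (map outs r) by apply/flatten_mapP; exists c' => //; exact: arcs_of_outs.
by move/dis; rewrite /= (arcs_of_outs dc).
Qed.

Lemma links_source {e x y} : links e y x ->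
  y = if (edge_ends e).2 == x then (edge_ends e).1 else (edge_ends e).2.
Proof. by rewrite /links; case: (edge_ends e) => a b /orP[] /eqP[-> ->] /=; rewrite ?eqxx //; case: eqP. Qed.

(** A directed path to [x] is the empty path at [i] or a path to the tail of an arc into [x],
    extended by that arc. Solving this equation in lists gives at once an enumeration and the
    recurrence for its length. *)
Lemma path_lists {S h} i : well_formed S -> {in arcs S, forall d, h d.1.1 < h d.2} ->
  exists P : port -> seq trail,
  [/\ forall x, size (P x) = (x == i) + incoming S (size \o P) x,
      forall x, uniq (P x) &
      forall x p st, ((p, st) \in P x) =
        [&& p == i, directed S p st & last p (unzip2 st) == x]].
Proof.
move=> wS rk.
pose ext x (y : oriented_edge * seq trail) (t : trail) : trail := (t.1, rcons t.2 (y.1.1.2, x)).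
have [P P_eq] := ranked_fixpoint ([::] : seq trail) (fun x L =>
  (if x == i then [:: (i, [::])] else [::]) ++ [seq ext x y t | y <- L, t <- y.2]) rk.
have memP x p st : ((p, st) \in P x) = [&& p == i, directed S p st & last p (unzip2 st) == x].
  elim/last_ind: st x => [|st [e q] ih] x.
    have nil_ext L : ((p, [::]) \in [seq ext x y t | y <- L, t <- y.2]) = false.
      by apply/negP => /allpairsPdep[y [t [_ _ []]]] _; case: (t.2).
    rewrite P_eq mem_cat nil_ext orbF /=; case: (x =P i) => [->|xi]; first by rewrite inE xpair_eqE eqxx andbT andbb.
    by rewrite in_nil; apply/esym/negbTE/negP => /= /andP[/eqP -> /eqP xi']; case: xi.
  rewrite P_eq mem_cat directed_rcons /unzip2 map_rcons last_rcons /=.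
  have -> : ((p, rcons st (e, q)) \in (if x == i then [:: (i, [::])] else [::])) = false.
    by case: ifP; rewrite ?in_nil // inE xpair_eqE -size_eq0 size_rcons andbF.
  apply/allpairsPdep/and3P => /= [[y [t [/mapP[d] ]]]|[/eqP pi /andP[dir arc] /eqP qx]].
    rewrite mem_filter => /andP[/eqP dx dS] -> /= tP [pt] /rcons_inj[stt eE qx].
    move: tP; rewrite [t]surjective_pairing -pt -stt ih => /and3P[-> -> /eqP lst].
    by rewrite lst eE qx -dx eqxx -!surjective_pairing dS.
  exists ((last p (unzip2 st), e, q), P (last p (unzip2 st))), (p, st); split => //=.
  - by apply/mapP; exists (last p (unzip2 st), e, q); rewrite // mem_filter /= qx eqxx -qx.
  - by rewrite ih pi eqxx -pi dir eqxx.
  - by rewrite /ext /= qx.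
exists P; split=> // x.
- rewrite {1}P_eq size_cat size_allpairs_dep /incoming -map_comp; congr (_ + _).
  by case: ifP.
(* Distinctness goes by induction on the rank, the tails of the arcs into [x] having lower rank. *)
- have [n] := ubnP (h x); elim: n x => // n ih x; rewrite ltnS => hx.
  have uP d : d \in [seq d <- arcs S | d.2 == x] -> uniq (P d.1.1).
    rewrite mem_filter => /andP[/eqP dx dS]; apply: ih; apply: leq_trans hx.
    by have := rk _ dS; rewrite dx.
  rewrite P_eq cat_uniq; apply/and3P; split; first by case: ifP.
    apply/hasPn => t /allpairsPdep[y [t' [_ _ ->]]] /=; case: ifP; rewrite ?in_nil // inE => _.
    by rewrite /ext xpair_eqE -size_eq0 size_rcons andbF.
  apply: allpairs_uniq_dep.
  + by rewrite map_inj_uniq ?filter_uniq ?uniq_arcs // => d d' [].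
  + by move=> y /mapP[d dx ->] /=; exact: uP.
  move=> [y t] [y' t'] /allpairsPdep[[d L] [s [/mapP[d0 d0x [dE LE]] _ e1]]].
  move=> /allpairsPdep[[d' L'] [s' [/mapP[d1 d1x [dE' LE']] _ e2]]] /=.
  case: e1 => yE _; case: e2 => y'E _; rewrite {}yE {}y'E dE LE dE' LE' /ext /=.
  case=> tt /rcons_inj[tt2 ee].
  (* An edge and its head determine the tail, so equal extensions come from the same arc. *)
  have dd : d0 = d1.
    move: d0x d1x ee {dE LE dE' LE'}; rewrite !mem_filter => /andP[/eqP x0 s0] /andP[/eqP x1 s1] ee.
    case: d0 x0 s0 ee => -[a0 b0] c0 /= -> /arc_edge[_ l0].
    case: d1 x1 s1 => -[a1 b1] c1 /= -> /arc_edge[_ l1] ee.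
    by rewrite (links_source l0) (links_source l1) ee.
  have -> : t = t' by rewrite [t]surjective_pairing [t']surjective_pairing tt tt2.
  by rewrite dd.
Qed.

(** ** Normal nets *)

Definition is_contr (c : component) : bool :=
  match c with Contr _ _ _ | Weak _ => true | _ => false end.

Definition principal (c : component) : port :=
  match c with Contr p _ _ | Cocontr p _ _ | Weak p | Coweak p => p | Wire s _ => s end.

Definition contr_auxs (c : component) : seq port :=
  if c is Contr _ a b then [:: a; b] else [::].

Definition contr_principals (S : seq component) := map principal (filter is_contr S).

Definition contr_leaves (S : seq component) := flatten (map contr_auxs (filter is_contr S)).

(** Reverses the orientation and exchanges the two families of cells:
    [contr_principals (map dual S)] lists the principal ports of cocontractions and coweakenings,
    and the output half of a routing area follows from the input half. *)
Definition dual (c : component) : component :=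
  match c with
  | Wire s e => Wire e s
  | Contr p a b => Cocontr p a b
  | Cocontr p a b => Contr p a b
  | Weak p => Coweak p
  | Coweak p => Weak p
  end.

Lemma dualK : involutive dual.
Proof. by case. Qed.

Lemma mem_map_dual c S : (c \in map dual S) = (dual c \in S).
Proof. by rewrite -[c in LHS]dualK mem_map //; exact: inv_inj dualK. Qed.

Lemma wire_sources_dual S : wire_sources (map dual S) = wire_ends S.
Proof. by rewrite /wire_sources -map_comp; congr flatten; apply: eq_map => -[]. Qed.

Lemma wire_ends_dual S : wire_ends (map dual S) = wire_sources S.
Proof. by rewrite /wire_ends -map_comp; congr flatten; apply: eq_map => -[]. Qed.

Lemma cell_sources_dual S : cell_sources (map dual S) = cell_ends S.
Proof. by rewrite /cell_sources -map_comp; congr flatten; apply: eq_map => -[]. Qed.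

Lemma cell_ends_dual S : cell_ends (map dual S) = cell_sources S.
Proof. by rewrite /cell_ends -map_comp; congr flatten; apply: eq_map => -[]. Qed.

Lemma cell_ports_dual S : cell_ports (map dual S) =i cell_ports S.
Proof. by move=> p; rewrite /cell_ports cell_sources_dual cell_ends_dual !mem_cat orbC. Qed.

Lemma well_formed_dual S : well_formed (map dual S) = well_formed S.
Proof.
rewrite /well_formed /wire_ports /cell_ports wire_sources_dual wire_ends_dual.
rewrite cell_sources_dual cell_ends_dual uniq_catC [uniq (cell_ends S ++ _)]uniq_catC.
by congr [&& _, _ & _]; rewrite andbC.
Qed.

Lemma free_in_dual S : free_in (map dual S) =1 free_out S.
Proof. by move=> p; rewrite /free_in wire_sources_dual cell_ports_dual. Qed.

Definition redex_free (S : seq component) : Prop :=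
  forall q p, Wire q p \in S -> q \in contr_principals (map dual S) ->
    p \in contr_principals S -> False.

(** Provides the well-formed reduct that a step must exhibit: the consumed ports [t1], [t2] give way
    to fresh [t1'], [t2'], while the interface ports [us], [ue] keep their wires in the context. *)
Lemma well_formed_replace {l r ctx us ue t1 t2 t1' t2'} :
  [/\ perm_eq (wire_sources l) t1, perm_eq (wire_ends l) t2,
      perm_eq (cell_sources l) (t1 ++ us) & perm_eq (cell_ends l) (t2 ++ ue)] ->
  [/\ perm_eq (wire_sources r) t1', perm_eq (wire_ends r) t2',
      perm_eq (cell_sources r) (t1' ++ us) & perm_eq (cell_ends r) (t2' ++ ue)] ->
  uniq (t1' ++ t2') -> {in t1' ++ t2', forall z, z \notin wire_ports (l ++ ctx)} ->
  well_formed (l ++ ctx) -> well_formed (r ++ ctx).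
Proof.
move=> [l1 l2 l3 l4] [r1 r2 r3 r4] ut fresh wl.
have wlU : uniq (wire_ports (l ++ ctx)) by case/and4P: wl.
have clU : uniq (cell_ports (l ++ ctx)) by case/and4P: wl.
have cl : perm_eq (cell_ports (l ++ ctx)) ((t1 ++ t2) ++ (us ++ ue) ++ cell_ports ctx).
  rewrite (perm_trans (perm_cell_ports_cat _ _)) // catA perm_cat2r.
  by rewrite (perm_trans (perm_cat l3 l4)) // perm_catACA.
have cr : perm_eq (cell_ports (r ++ ctx)) ((t1' ++ t2') ++ (us ++ ue) ++ cell_ports ctx).
  rewrite (perm_trans (perm_cell_ports_cat _ _)) // catA perm_cat2r.
  by rewrite (perm_trans (perm_cat r3 r4)) // perm_catACA.
have wr : perm_eq (wire_ports (r ++ ctx)) ((t1' ++ t2') ++ wire_ports ctx).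
  by rewrite (perm_trans (perm_wire_ports_cat _ _)) // perm_cat2r perm_cat.
move: clU; rewrite (perm_uniq cl) cat_uniq => /and3P[_ /hasPn old ucl].
apply/and4P; split.
- rewrite (perm_uniq wr) cat_uniq ut /=; apply/andP; split.
    apply/hasPn => z zc; apply/negP => /fresh; by rewrite mem_wire_ports_cat zc orbT.
  by move: wlU; rewrite (perm_uniq (perm_wire_ports_cat _ _)) cat_uniq => /and3P[].
- rewrite (perm_uniq cr) cat_uniq ut ucl andbT; apply/hasPn => z zc; apply/negP => /fresh.
  by rewrite (cell_portW wl) // (perm_mem cl) [z \in (t1 ++ t2) ++ _]mem_cat zc orbT.
- apply/allP => z; rewrite cell_sources_cat wire_sources_cat /= !mem_cat (perm_mem r3) (perm_mem r1).
  rewrite mem_cat -orbA => /or3P[->//|zus|zc]; apply/orP; right.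
    (* A wire of [l] at an interface port would place the port in [t1], and so twice among the cell
       ports. *)
    have := @cell_sourceW _ z wl; rewrite cell_sources_cat wire_sources_cat !mem_cat.
    rewrite (perm_mem l3) (perm_mem l1) mem_cat zus orbT => /(_ isT)/orP[zt|//].
    by have := old z; rewrite !mem_cat zus zt => /(_ isT).
  have := @cell_sourceW _ z wl; rewrite cell_sources_cat wire_sources_cat !mem_cat.
  rewrite (perm_mem l1) zc orbT => /(_ isT)/orP[zt|//].
  by have := old z; rewrite !mem_cat zc zt !orbT => /(_ isT).
- apply/allP => z; rewrite cell_ends_cat wire_ends_cat /= !mem_cat (perm_mem r4) (perm_mem r2).
  rewrite mem_cat -orbA => /or3P[->//|zus|zc]; apply/orP; right.
    have := @cell_endW _ z wl; rewrite cell_ends_cat wire_ends_cat !mem_cat.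
    rewrite (perm_mem l4) (perm_mem l2) mem_cat zus orbT => /(_ isT)/orP[zt|//].
    by have := old z; rewrite !mem_cat zus zt !orbT => /(_ isT).
  have := @cell_endW _ z wl; rewrite cell_ends_cat wire_ends_cat !mem_cat.
  rewrite (perm_mem l2) zc orbT => /(_ isT)/orP[zt|//].
  by have := old z; rewrite !mem_cat zc zt !orbT => /(_ isT).
Qed.

Lemma perm_mem3 {S : seq component} {c1 c2 c3} : c1 \in S -> c2 \in S -> c3 \in S ->
  uniq [:: c1; c2; c3] -> exists ctx, perm_eq S ([:: c1; c2; c3] ++ ctx).
Proof.
move=> s1 s2 s3 /=; rewrite !inE negb_or !andbT => /andP[/andP[n12 n13] n23].
have e1 := perm_to_rem s1.
have m2 : c2 \in rem c1 S by move: s2; rewrite (perm_mem e1) inE eq_sym (negbTE n12).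
have e2 := perm_to_rem m2.
have m3 : c3 \in rem c2 (rem c1 S).
  move: s3; rewrite (perm_mem e1) inE eq_sym (negbTE n13) /= (perm_mem e2) inE eq_sym.
  by rewrite (negbTE n23).
exists (rem c3 (rem c2 (rem c1 S))).
rewrite (perm_trans e1) //= perm_cons (perm_trans e2) //= perm_cons.
exact: perm_to_rem.
Qed.

(** Each of the four possible facing pairs is a redex with a well-formed reduct, against
    normality. *)
Lemma normal_redex_free {S : net} : normal S -> redex_free S.
Proof.
move=> nS q p wS qS pS.
have no l r ctx : reduction_rule l r -> perm_eq S (l ++ ctx) -> well_formed (r ++ ctx) -> False.
  by move=> rule e w; apply: (nS (Net w)); exists l, r, ctx.
have wf l ctx : perm_eq S (l ++ ctx) -> well_formed (l ++ ctx).
  by move=> /perm_well_formed <-; exact: net_well_formed.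
case/mapP: qS => cq; rewrite mem_filter mem_map_dual => /andP[cq1 cqS] qE.
case/mapP: pS => cp; rewrite mem_filter => /andP[cp1 cpS] pE.
case: cq cq1 cqS qE => [s e|q' a b|q' a b|q'|q'] //= _ cqS qE; subst q';
case: cp cp1 cpS pE => [s e|p' c d|p' c d|p'|p'] //= _ cpS pE; subst p'.
- have [//|ctx e] := perm_mem3 cqS wS cpS.
  (* [m] exceeds every port name, so [m] to [m + 7] can name the eight new ports. *)
  pose m := (\max_(z <- wire_ports S) z).+1.
  have lt z i : z \in wire_ports S -> z < m + i.
    by move=> zS; rewrite ltn_addr // ltnS; apply: (@leq_bigmax_seq _ _ xpredT id).
  apply: (no _ _ ctx (red_ba q a b p c d m (m + 4) (m + 1) (m + 5) (m + 2) (m + 6) (m + 3) (m + 7))) => //.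
  apply: (@well_formed_replace _ _ ctx [:: c; d] [:: a; b] [:: q] [:: p]
    [:: m; m + 1; m + 2; m + 3] [:: m + 4; m + 5; m + 6; m + 7] _ _ _ _ (wf _ _ e)).
  + by split; solve_perm.
  + by split; solve_perm.
  + by rewrite /= !inE; lia.
  + move=> z; rewrite -(perm_mem (perm_wire_ports e)) => zt; apply/negP => zS.
    by have := lt z 0 zS; move: zt; rewrite !inE; lia.
- have [//|ctx e] := perm_mem3 cqS wS cpS.
  apply: (no _ _ ctx (red_s2 q a b p)) => //.
  apply: (@well_formed_replace _ _ ctx [::] [:: a; b] [:: q] [:: p] [::] [::] _ _ _ _ (wf _ _ e)) => //;
  by split; solve_perm.
- have [//|ctx e] := perm_mem3 cqS wS cpS.
  apply: (no _ _ ctx (red_s1 q p c d)) => //.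
  apply: (@well_formed_replace _ _ ctx [:: c; d] [::] [:: q] [:: p] [::] [::] _ _ _ _ (wf _ _ e)) => //;
  by split; solve_perm.
- have [//|ctx e] := perm_mem3 cqS wS cpS.
  apply: (no _ _ ctx (red_eps q p)) => //.
  apply: (@well_formed_replace _ _ ctx [::] [::] [:: q] [:: p] [::] [::] _ _ _ _ (wf _ _ e)) => //;
  by split; solve_perm.
Qed.

(* The total load counts the directed paths from a cocontraction or coweakening to a contraction
   or weakening; each reduction step destroys exactly one of them. *)
Lemma reduces_to_normal {S : net} {u h} : all (flow 1 u) S -> all (increasing h) S ->
  exists S' : net, [/\ reduces S S', normal S' & exists h', all (increasing h') S'].
Proof.
have [n] := ubnP (sumn (map (load u) S)); elim: n S u h => // n ih S u h lt fu inch.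
have [[S1 st]|nS] := pselect (exists S1, step S S1); last first.
  by exists S; split; [exact: rt_refl|move=> S1 st; apply: nS; exists S1|exists h].
have [l [r [ctx [rule e e']]]] := st; have [uw uc] := uniq_rule_ports e'.
have w : well_formed (r ++ ctx) by rewrite -(perm_well_formed e') net_well_formed.
have fu' : all (flow 1 u) (l ++ ctx) by rewrite -(perm_all _ e).
have ih' : all (increasing h) (l ++ ctx) by rewrite -(perm_all _ e).
have [fl _] := andP (etrans (esym (all_cat _ _ _)) fu').
have [il _] := andP (etrans (esym (all_cat _ _ _)) ih').
have [u1 [upd fr ld]] := flow_reduction 1 u rule uw uc fl.
have [h1 updh ihr] := increasing_reduction h rule uw uc il.
have [] := ih S1 u1 h1.
- move: lt; rewrite (perm_sumn (perm_map _ e)) (perm_sumn (perm_map _ e')).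
  by rewrite !map_cat !sumn_cat (load_update w upd) -ld addn1 addSn ltnS => /leq_trans; apply.
- by rewrite (perm_all _ e'); exact: all_update (local_flow 1) w upd fu' fr.
- by rewrite (perm_all _ e'); exact: all_update local_increasing w updh ih' ihr.
move=> S2 [red nS2 hS2]; exists S2; split=> //.
by apply: rt_trans red; apply: rt_step; right.
Qed.

(** ** Forests of contraction trees *)

Lemma exists_min {T : eqType} (f : T -> nat) {s : seq T} : s != [::] ->
  exists2 c, c \in s & {in s, forall c', f c <= f c'}.
Proof.
elim: s => // a [|b s] ih _; first by exists a; rewrite ?inE // => c; rewrite inE => /eqP ->.
have [//|c cs cm] := ih; have [ac|ca] := leqP (f a) (f c).
  by exists a; rewrite ?inE ?eqxx // => d; rewrite inE => /orP[/eqP ->//|/cm]; exact: leq_trans.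
exists c; first by rewrite inE cs orbT.
by move=> d; rewrite inE => /orP[/eqP ->|/cm //]; exact: ltnW.
Qed.

Lemma flatten_map1 {T : Type} (R : Type) (f : T -> R) s : flatten [seq [:: f x] | x <- s] = map f s.
Proof. by elim: s => //= x s ->. Qed.

(** Induction on the number of cells. A cell whose source port has least rank hangs from a root,
    since that source cannot be an auxiliary port. Its removal turns its auxiliary ports into roots,
    whose trees are then grafted back. *)
Lemma contr_forest (src : port -> port) (h : port -> nat) (A : seq component) (X : seq port) :
  all is_contr A -> uniq (X ++ flatten (map contr_auxs A)) ->
  uniq [seq src (principal c) | c <- A] ->
  {subset [seq src (principal c) | c <- A] <= X ++ flatten (map contr_auxs A)} ->
  {in A, forall c, {in contr_auxs c, forall a, h (src (principal c)) < h a}} ->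
  exists (l : port -> seq port) (T : port -> seq component),
  [/\ {in X, forall x, contr_tree x (l x) (T x)},
      perm_eq (flatten (map T X))
        (flatten [seq [:: Wire (src (principal c)) (principal c); c] | c <- A]) &
      perm_eq (X ++ flatten (map contr_auxs A))
        ([seq src (principal c) | c <- A] ++ flatten (map l X))].
Proof.
have [n] := ubnP (size A); elim: n A X => // n ih A X; rewrite ltnS => sA cA uX uA sub hA.
have [A0|nA] := eqVneq A [::].
  exists (fun x => [:: x]), (fun=> [::]); rewrite A0 /= cats0 flatten_map1 map_id; split => //.
    by move=> x _; exact: contr_tree_wire.
  by elim: (X).
have [c cin cmin] := exists_min (fun c => h (src (principal c))) nA.
pose x := src (principal c).
have xX : x \in X.
  have : x \in X ++ flatten (map contr_auxs A) by apply: sub; apply: map_f cin.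
  rewrite mem_cat => /orP[//|/flatten_mapP[c' c'A xc']].
  by have := hA _ c'A _ xc'; rewrite ltnNge (cmin _ c'A).
have eA := perm_to_rem cin; have eX := perm_to_rem xX.
set A' := rem c A in eA; set X0 := rem x X in eX.
(* The root [x] is replaced by the auxiliary ports of the removed cell: two for a contraction, none
   for a weakening. *)
pose X' := contr_auxs c ++ X0.
have eXA : perm_eq (X ++ flatten (map contr_auxs A)) (x :: (X' ++ flatten (map contr_auxs A'))).
  rewrite (perm_trans (perm_cat eX (perm_flatten_map contr_auxs eA))) //=.
  by rewrite perm_cons catA perm_cat2r perm_catC.
have := uX; rewrite (perm_uniq eXA) => /= /andP[xX' uX'].
have := uA; rewrite (perm_uniq (perm_map _ eA)) => /= /andP[xA' uA'].
have cA' : is_contr c && all is_contr A' by move: cA; rewrite (perm_all _ eA).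
have [] := ih A' X'.
- by rewrite size_rem // (leq_trans _ sA) // ltn_predL; case: (A) cin.
- by case/andP: cA'.
- exact: uX'.
- exact: uA'.
- move=> y yA'; have : y \in x :: (X' ++ flatten (map contr_auxs A')).
    by rewrite -(perm_mem eXA); apply: sub; rewrite (perm_mem (perm_map _ eA)) inE yA' orbT.
  by rewrite inE => /orP[/eqP yx|//]; case/negP: xA'; move: yA'; rewrite yx.
- by move=> c' c'A; apply: hA; exact: mem_rem c'A.
move=> l' [T' [tree eT el]].
pose l z := if z == x then flatten (map l' (contr_auxs c)) else l' z.
pose T z := if z == x then [:: Wire x (principal c); c] ++ flatten (map T' (contr_auxs c)) else T' z.
have x0 : x \notin X0 by move: xX'; rewrite !mem_cat !negb_or => /andP[/andP[]].
have neq z : z \in X0 -> (z == x) = false by move=> zX; apply: contraNF x0 => /eqP <-.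
have lX0 : map l X0 = map l' X0 by apply/eq_in_map => z zX; rewrite /l neq.
have TX0 : map T X0 = map T' X0 by apply/eq_in_map => z zX; rewrite /T neq.
exists l, T; split.
- move=> z; rewrite (perm_mem eX) inE => /orP[/eqP ->|zX]; last first.
    by rewrite /l /T neq //; apply: tree; rewrite mem_cat zX orbT.
  rewrite /l /T eqxx /=; move: cA' tree; rewrite /X'.
  case: (c) => [s e|p a b|p a b|p|p] //= _ tree; last exact: contr_tree_weak.
  by rewrite !cats0; apply: contr_tree_node; apply: tree; rewrite !inE eqxx ?orbT.
- apply: (perm_trans (perm_flatten (perm_map T eX))).
  have := perm_flatten (perm_map (fun c => [:: Wire (src (principal c)) (principal c); c]) eA).
  rewrite perm_sym; apply: perm_trans; rewrite /= TX0 {1}/T eqxx.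
  by rewrite /= !perm_cons -flatten_cat -map_cat.
- apply: (perm_trans eXA); rewrite perm_sym.
  apply: (perm_trans (perm_cat (perm_map _ eA) (perm_flatten (perm_map l eX)))).
  by rewrite /= perm_cons lX0 {1}/l eqxx -flatten_cat -map_cat perm_sym.
Qed.

(** ** Routing areas *)

Definition wires (S : seq component) : seq (port * port) :=
  flatten [seq if c is Wire s e then [:: (s, e)] else [::] | c <- S].

Lemma unzip1_wires S : unzip1 (wires S) = wire_sources S.
Proof. by rewrite /wires /unzip1 map_flatten -map_comp; congr flatten; apply: eq_map => -[]. Qed.

Lemma unzip2_wires S : unzip2 (wires S) = wire_ends S.
Proof. by rewrite /wires /unzip2 map_flatten -map_comp; congr flatten; apply: eq_map => -[]. Qed.

Lemma mem_wires S w : (w \in wires S) = (Wire w.1 w.2 \in S).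
Proof.
apply/flatten_mapP/idP => [[[s e|p a b|p a b|p|p] cS] //|wS].
  by rewrite inE => /eqP ->.
by exists (Wire w.1 w.2); rewrite // inE -surjective_pairing.
Qed.

Definition swap (w : port * port) := (w.2, w.1).

Lemma wires_dual S : wires (map dual S) = map swap (wires S).
Proof. by rewrite /wires map_flatten -!map_comp; congr flatten; apply: eq_map => -[]. Qed.

Lemma perm_cell_sources S :
  perm_eq (cell_sources S) (contr_leaves S ++ contr_principals (map dual S)).
Proof.
pose coprincipal c := if is_contr (dual c) then [:: principal c] else [::].
have -> : cell_sources S = flatten [seq contr_auxs c ++ coprincipal c | c <- S].
  by congr flatten; apply: eq_map => -[].
have -> : contr_leaves S = flatten (map contr_auxs S).
  by rewrite /contr_leaves; elim: S => //= -[s e|p a b|p a b|p|p] S /= ->.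
have -> : contr_principals (map dual S) = flatten (map coprincipal S).
  by rewrite /contr_principals; elim: S => //= -[s e|p a b|p a b|p|p] S /= ->.
exact: perm_flatten_map_cat.
Qed.

Lemma contr_principals_ends {S} : {subset contr_principals S <= cell_ends S}.
Proof.
move=> p /mapP[c]; rewrite mem_filter => /andP[ic cS] ->.
by case: c ic cS => [s e|q a b|q a b|q|q] //= _ cS; [have [] := mem_contr cS|exact: mem_weak cS].
Qed.

Lemma uniq_contr_principals {S} : well_formed S -> uniq (contr_principals S).
Proof.
move=> wS; have := uniq_cell_ends wS; rewrite -cell_sources_dual.
rewrite (perm_uniq (perm_cell_sources _)) cat_uniq => /and3P[_ _].
by rewrite (mapK dualK).
Qed.

(** In a normal net, the wires joining leaves of contraction trees to leaves of cocontraction trees;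
    they become the [W] of the routing area. *)
Definition internal_wires (S : seq component) : seq (port * port) :=
  [seq w <- wires S | (w.2 \notin contr_principals S) && (w.1 \notin contr_principals (map dual S))].

(** The first two classes are disjoint because no wire joins the two principal ports of a redex. *)
Lemma perm_wires_split {S} : redex_free S ->
  perm_eq (wires S) ([seq w <- wires S | w.2 \in contr_principals S] ++
   [seq w <- wires S | w.1 \in contr_principals (map dual S)] ++ internal_wires S).
Proof.
move=> rf; pose rest := [seq w <- wires S | w.2 \notin contr_principals S].
have -> : [seq w <- wires S | w.1 \in contr_principals (map dual S)] =
    [seq w <- rest | w.1 \in contr_principals (map dual S)].
  rewrite -filter_predI; apply: eq_in_filter => w; rewrite mem_wires /= => wS'.
  by case w1: (w.1 \in _) => //=; apply/esym/negP => /(rf _ _ wS' w1).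
have -> : internal_wires S = [seq w <- rest | w.1 \notin contr_principals (map dual S)].
  by rewrite -filter_predI; apply: eq_filter => w /=; rewrite andbC.
have e2 : perm_eq ([seq w <- rest | w.1 \in contr_principals (map dual S)] ++
    [seq w <- rest | w.1 \notin contr_principals (map dual S)]) rest.
  exact/permPl/perm_filterC.
have e1 : perm_eq ([seq w <- wires S | w.2 \in contr_principals S] ++ rest) (wires S).
  exact/permPl/perm_filterC.
by rewrite perm_sym; apply: perm_trans e1; rewrite perm_cat2l.
Qed.

(** The input half of a routing area. The leaves of the forest are identified with the sources of
    internal wires by counting the wire sources in two ways. *)
Lemma contr_half {S h} (I : seq port) : well_formed S -> redex_free S ->
  (forall s e, Wire s e \in S -> h s < h e) ->
  (forall p a b, Contr p a b \in S -> h p < h a /\ h p < h b) ->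
  uniq I -> I =i free_in S ->
  exists (l : port -> seq port) (T : port -> seq component),
  [/\ {in I, forall x, contr_tree x (l x) (T x)},
      perm_eq (flatten (map T I))
        ([seq Wire w.1 w.2 | w <- wires S & w.2 \in contr_principals S] ++ filter is_contr S) &
      perm_eq (unzip1 (internal_wires S)) (flatten (map l I))].
Proof.
move=> wS rf hW hC uI eI.
(* [src p] is the source of the wire ending at [p], found by position. *)
pose src p := nth 0 (wire_sources S) (index p (wire_ends S)).
have srcE s e : (s, e) \in wires S -> s = src e.
  move=> sS; rewrite /src -unzip1_wires -unzip2_wires.
  have := uniq_wire_ends wS; rewrite -unzip2_wires.
  elim: (wires S) sS => //= -[a b] r ih; rewrite inE => /orP[/eqP[-> ->]|sr] /=; first by rewrite eqxx.
  case/andP=> br ur; case: eqP => [be|_]; last exact: ih.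
  by case/negP: br; apply/mapP; exists (s, e).
have srcW p : p \in wire_ends S -> (src p, p) \in wires S.
  by rewrite -unzip2_wires => /mapP[[s e] sS /= ->]; rewrite -(srcE s e).
have uwires : uniq (wires S) by apply: (@map_uniq _ _ fst); rewrite -/(unzip1 _) unzip1_wires uniq_wire_sources.
pose A := filter is_contr S.
have W1 : perm_eq [seq w <- wires S | w.2 \in contr_principals S]
    [seq (src (principal c), principal c) | c <- A].
  apply: uniq_perm; first exact: filter_uniq.
    apply: (@map_uniq _ _ snd); rewrite -map_comp; exact: uniq_contr_principals.
  move=> [s e]; rewrite mem_filter /=; apply/andP/mapP => [[/mapP[c cA ->] sS]|[c cA [-> ->]]].
    by exists c => //; rewrite -(srcE _ _ sS).
  have pc : principal c \in contr_principals S by exact: map_f.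
  by split=> //; apply/srcW/(cell_endW wS)/contr_principals_ends.
have ucs := uniq_cell_sources wS.
move: (ucs); rewrite (perm_uniq (perm_cell_sources S)) cat_uniq => /and3P[ul _ uc].
have leafS : {subset contr_leaves S <= cell_sources S}.
  by move=> z zl; rewrite (perm_mem (perm_cell_sources S)) mem_cat zl.
have [] := @contr_forest src h A I.
- exact: filter_all.
- rewrite cat_uniq uI ul andbT; apply/hasPn => z /leafS zc; apply/negP; rewrite /= eI.
  by case/andP=> _; rewrite mem_cat zc.
- have -> : [seq src (principal c) | c <- A] = unzip1 [seq (src (principal c), principal c) | c <- A].
    by rewrite /unzip1 -map_comp.
  rewrite -(perm_uniq (perm_map _ W1)) /unzip1; apply: (subseq_uniq (map_subseq _ (filter_subseq _ _))).
  by rewrite -/(unzip1 _) unzip1_wires uniq_wire_sources.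
- move=> x /mapP[c cA ->]; set s := src _.
  have pc : principal c \in contr_principals S by exact: map_f.
  have wsS : (s, principal c) \in wires S by apply/srcW/(cell_endW wS)/contr_principals_ends.
  have sS : s \in wire_sources S by rewrite -unzip1_wires; exact: (map_f fst wsS).
  (* A source that is not an input is a cell source; the absence of redexes rules out the principal
     port of a cocontraction or coweakening, which leaves an auxiliary port of a contraction. *)
  rewrite mem_cat eI unfold_in /free_in sS /=; case sc: (s \in cell_ports S) => //=.
  have : s \in cell_sources S.
    move: sc; rewrite mem_cat => /orP[//|/(cell_endW wS)]; by rewrite (source_not_end wS sS).
  rewrite (perm_mem (perm_cell_sources S)) mem_cat => /orP[//|sc'].
  by case: (rf s (principal c)) => //; rewrite mem_wires in wsS.
- move=> c; rewrite mem_filter => /andP[ic cS] a ac.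
  have pc : principal c \in contr_principals S by apply: map_f; rewrite mem_filter ic.
  have : (src (principal c), principal c) \in wires S.
    by apply/srcW/(cell_endW wS)/contr_principals_ends.
  rewrite mem_wires => /hW /= lt; apply: (ltn_trans lt).
  case: c {ic pc lt} cS ac => // p a' b' /hC[ha hb].
  by rewrite !inE => /orP[] /eqP ->.
move=> l [T [tree eT el]]; exists l, T; split=> //.
  apply: (perm_trans eT); rewrite (perm_trans (perm_flatten_map_cat (fun c => [:: Wire _ _]) (fun c => [:: c]) A)) //.
  rewrite !flatten_map1 map_id perm_cat2r perm_sym.
  by apply: (perm_trans (perm_map (fun w => Wire w.1 w.2) W1)); rewrite -map_comp.
have W1s : perm_eq (unzip1 [seq w <- wires S | w.2 \in contr_principals S]) [seq src (principal c) | c <- A].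
  by apply: (perm_trans (perm_map fst W1)); rewrite -map_comp.
have cocW : {subset contr_principals (map dual S) <= wire_sources S}.
  by move=> z zc; apply: (cell_sourceW wS); rewrite (perm_mem (perm_cell_sources S)) mem_cat zc orbT.
have W2s : perm_eq (unzip1 [seq w <- wires S | w.1 \in contr_principals (map dual S)])
    (contr_principals (map dual S)).
  rewrite /unzip1 -filter_map -/(unzip1 _) unzip1_wires.
  apply: uniq_perm; [by rewrite filter_uniq ?uniq_wire_sources|exact: uc|move=> z].
  by rewrite mem_filter; apply/andP/idP => [[]//|zc]; split=> //; exact: cocW.
have srcs : perm_eq (wire_sources S) (I ++ cell_sources S).
  apply: uniq_perm; first exact: uniq_wire_sources.
    rewrite cat_uniq uI ucs andbT; apply/hasPn => z zc; apply/negP; rewrite /= eI.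
    by case/andP=> _; rewrite mem_cat zc.
  move=> z; rewrite mem_cat eI; apply/idP/orP => [zs|[/andP[]//|/(cell_sourceW wS)//]].
  case zc: (z \in cell_ports S); last by left; apply/andP; rewrite zs zc.
  right; move: zc; rewrite mem_cat => /orP[//|/(cell_endW wS)].
  by rewrite (source_not_end wS zs).
(* The wire sources are listed by class of wire on one side, as inputs and cell sources on the
   other; the common parts cancel. *)
have e0 := perm_map fst (perm_wires_split rf); rewrite !map_cat -!/(unzip1 _) unzip1_wires in e0.
have e1 := perm_trans e0 (perm_cat W1s (perm_cat W2s (perm_refl _))).
have e2 := perm_trans srcs (perm_cat (perm_refl I) (perm_cell_sources S)).
rewrite catA in e2; have e3 := perm_trans e2 (perm_cat el (perm_refl _)).
have : perm_eq ([seq src (principal c) | c <- A] ++ contr_principals (map dual S) ++ unzip1 (internal_wires S))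
  ([seq src (principal c) | c <- A] ++ contr_principals (map dual S) ++ flatten (map l I)).
  rewrite perm_sym in e1; apply: (perm_trans e1); apply: (perm_trans e3).
  by rewrite -catA perm_cat2l perm_catC.
by rewrite !perm_cat2l.
Qed.

Lemma contr_tree_dual x l T : contr_tree x l T -> cocontr_tree x l (map dual T).
Proof.
elim=> {x l T} [x|x p|x p a b la lb Ta Tb _ ta _ tb] /=.
- exact: cocontr_tree_wire.
- exact: cocontr_tree_coweak.
- by rewrite map_cat; exact: cocontr_tree_node.
Qed.

Lemma perm_contr_parts S :
  perm_eq S (filter is_contr S ++ map dual (filter is_contr (map dual S)) ++
    [seq Wire w.1 w.2 | w <- wires S]).
Proof.
pose f c := if is_contr c then [:: c] else [::].
pose g c := if is_contr (dual c) then [:: c] else [::].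
pose k c := if c is Wire s e then [:: Wire s e] else [::].
have eF r : filter is_contr r = flatten (map f r).
  by elim: r => //= c r ->; rewrite /f; case: (is_contr c).
have eG r : map dual (filter is_contr (map dual r)) = flatten (map g r).
  by elim: r => //= c r <-; rewrite /g; case: (is_contr (dual c)) => //=; rewrite dualK.
have eK : [seq Wire w.1 w.2 | w <- wires S] = flatten (map k S).
  by rewrite /wires map_flatten -map_comp; congr flatten; apply: eq_map => -[].
rewrite eF eG eK -[X in perm_eq X _](map_id S) -flatten_map1.
have -> : [seq [:: c] | c <- S] = [seq f c ++ (g c ++ k c) | c <- S] by apply: eq_map => -[].
apply: (perm_trans (perm_flatten_map_cat _ _ S)); rewrite perm_cat2l.
exact: perm_flatten_map_cat.
Qed.

Lemma flatten_fset (T : Type) (I : {fset port}) (f : port -> seq T) :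
  flatten [seq f (val i) | i : I] = flatten (map f (enum_fset I)).
Proof. by rewrite enum_fsetE -map_comp. Qed.

Lemma normal_routing_area {S : net} {h} {I O : {fset port}} :
  normal S -> all (increasing h) S -> I =i free_in S -> O =i free_out S ->
  exists R : multirelation I O, routing_area R S.
Proof.
move=> nS /allP hS eI eO; have wS := net_well_formed S.
have rf := normal_redex_free nS.
have [||lI [TI [treeI eTI eWI]]] := @contr_half S h (enum_fset I) wS rf _ _ (fset_uniq I) eI.
- by move=> s e /hS.
- by move=> p a b /hS /andP.
(* The dual net needs the reversed rank [m - h z]; as [m] bounds the ranks of all ports, the
   truncated subtraction stays strict. *)
pose m := \max_(z <- wire_ports S) h z.
have hm z : z \in wire_ports S -> h z <= m.
  by move=> zS; apply: (@leq_bigmax_seq _ _ xpredT h).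
have mono x y : y \in wire_ports S -> h x < h y -> m - h y < m - h x.
  by move=> /hm; lia.
have wD : well_formed (map dual S) by rewrite well_formed_dual.
have rfD : redex_free (map dual S).
  move=> q p; rewrite mem_map_dual (mapK dualK) => /= wqp q1 p1; exact: rf wqp p1 q1.
have eOD : O =i free_in (map dual S) by move=> z; rewrite eO; exact: esym (free_in_dual S z).
have [||lO [TO [treeO eTO eWO]]] :=
    @contr_half _ (fun z => m - h z) (enum_fset O) wD rfD _ _ (fset_uniq O) eOD.
- move=> s e; rewrite mem_map_dual => /= c; apply: mono; last exact: hS _ c.
  by rewrite mem_cat (mem_wire_end c) orbT.
- move=> p a b; rewrite mem_map_dual => /= c; have /andP[ha hb] := hS _ c.
  have [pS _ _] := mem_cocontr c.
  have pW : p \in wire_ports S by rewrite mem_cat (cell_sourceW wS pS).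
  by split; apply: mono.
pose W := internal_wires S.
exists [ffun x => count (fun w => (w.1 \in lI (val x.1)) && (w.2 \in lO (val x.2))) W].
exists (fun i => lI (val i)), (fun i => TI (val i)), (fun o => lO (val o)),
  (fun o => map dual (TO (val o))), W; split.
- split=> [i|o]; first exact/treeI/valP.
  by apply: contr_tree_dual; apply/treeO/valP.
- by rewrite flatten_fset.
- rewrite (flatten_fset _ _ lO); apply: perm_trans eWO.
  suff -> : internal_wires (map dual S) = map swap W by rewrite /unzip1 -map_comp.
  rewrite /internal_wires wires_dual filter_map (mapK dualK); congr map.
  by apply: eq_filter => w /=; rewrite andbC.
- by move=> i o; rewrite ffunE.
- rewrite flatten_fset (flatten_fset _ _ (map dual \o TO)).
  apply: (perm_trans (perm_contr_parts S)).
  have perm_wires : perm_eq [seq Wire w.1 w.2 | w <- wires S]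
      ([seq Wire w.1 w.2 | w <- wires S & w.2 \in contr_principals S] ++
       [seq Wire w.1 w.2 | w <- wires S & w.1 \in contr_principals (map dual S)] ++
       [seq Wire w.1 w.2 | w <- W]).
    by rewrite -!map_cat; apply/perm_map/(perm_wires_split rf).
  have eTO' := perm_map dual eTO.
  rewrite map_cat map_flatten -map_comp in eTO'.
  have eD : map dual [seq Wire w.1 w.2 | w <- wires (map dual S) & w.2 \in contr_principals (map dual S)]
      = [seq Wire w.1 w.2 | w <- wires S & w.1 \in contr_principals (map dual S)].
    by rewrite wires_dual filter_map -!map_comp.
  rewrite eD in eTO'.
  rewrite perm_sym; apply: (perm_trans (perm_cat eTI (perm_cat eTO' (perm_refl _)))).
  rewrite perm_sym; apply: (perm_trans (perm_cat (perm_refl _) (perm_cat (perm_refl _) perm_wires))).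
  have ac a b c d e : a + (b + (c + (d + e))) = c + a + (d + b + e) by lia.
  apply/permP => P; rewrite !count_cat; exact: ac.
Qed.

(** * Solutions on a routing area *)

Lemma contr_tree_flow {x l T v} : contr_tree x l T -> all (flow 0 v) T ->
  {in l, forall y, v y = v x}.
Proof.
elim=> {x l T} [x|x p|x p a b la lb Ta Tb _ iha _ ihb] /=.
- by move=> _ y; rewrite inE => /eqP ->.
- by [].
rewrite all_cat => /and3P[/eqP px /andP[/eqP ap /eqP bp] /andP[/iha va /ihb vb]] y.
by rewrite mem_cat => /orP[/va|/vb] ->; rewrite ?ap ?bp px.
Qed.

Lemma cocontr_tree_flow {y l T v} : cocontr_tree y l T -> all (flow 0 v) T ->
  v y = sumn (map v l).
Proof.
elim=> {y l T} [y|y p|y p a b la lb Ta Tb _ iha _ ihb] /=.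
- by rewrite addn0.
- by move=> /and3P[/eqP -> /eqP ->].
rewrite all_cat map_cat sumn_cat => /and3P[/eqP -> /eqP -> /andP[/iha va /ihb vb]].
by rewrite addn0 va vb.
Qed.

Lemma mem_flatten_codom {T : eqType} {I : finType} {f : I -> seq T} {i x} :
  x \in f i -> x \in flatten [seq f i | i : I].
Proof. by move=> xi; apply/flatten_mapP; exists i; rewrite ?mem_enum. Qed.

(** The leaves of [i] carry 1 and those of the other inputs 0, so the sum at [o] counts the wires
    from [i] to [o]. *)
Lemma routing_area_flow {S : net} {I O : {fset port}} {R : multirelation I O} {v} (i : I) (o : O) :
  routing_area R S -> all (flow 0 v) S -> (forall j : I, v (val j) = (j == i)) ->
  v (val o) = R (i, o).
Proof.
case=> lI [TI [lO [TO [W [[treeI treeO] eI eO -> e]]]]].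
rewrite (perm_all _ e) !all_cat => /and3P[/allP fI /allP fO /allP fW] vI.
have {}fI j : all (flow 0 v) (TI j).
  by apply/allP => c cT; apply: fI; exact: mem_flatten_codom cT.
have {}fO j : all (flow 0 v) (TO j).
  by apply/allP => c cT; apply: fO; exact: mem_flatten_codom cT.
have {}fW w : w \in W -> v w.2 = v w.1 by move=> /(map_f (fun w => Wire w.1 w.2))/fW/eqP.
have uW2 : uniq (unzip2 W).
  have := uniq_wire_ends (net_well_formed S).
  rewrite (perm_uniq (perm_flatten_map _ e)) -/(wire_ends _) !wire_ends_cat catA cat_uniq.
  case/and3P=> _ _; rewrite -(unzip2_wires [seq _ | w <- W]).
  suff -> : wires [seq Wire w.1 w.2 | w <- W] = W by [].
  by rewrite /wires -map_comp; elim: (W) => //= -[s t] r ->.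
(* Each leaf of [o] ends exactly one wire of [W], which turns the sum over leaves into a sum over
   wires. *)
have eL : perm_eq (lO o) [seq w.2 | w <- W & w.2 \in lO o].
  have ul : uniq (lO o).
    have : uniq (flatten [seq lO o | o : O]) by rewrite -(perm_uniq eO).
    by move/uniq_flatten_map_sub; apply; rewrite mem_enum.
  apply: uniq_perm => // [|z]; first by apply: subseq_uniq (map_subseq _ (filter_subseq _ _)) uW2.
  apply/idP/mapP => [zl|[w]]; last by rewrite mem_filter => /andP[wl _] ->.
  have : z \in unzip2 W by rewrite (perm_mem eO) (mem_flatten_codom zl).
  by case/mapP=> w wW zE; exists w; rewrite // mem_filter -zE zl.
rewrite (cocontr_tree_flow (treeO o) (fO o)) (perm_sumn (perm_map v eL)) -map_comp.
have -> : [seq (v \o snd) w | w <- W & w.2 \in lO o] =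
    [seq nat_of_bool (w.1 \in lI i) | w <- W & w.2 \in lO o].
  apply/eq_in_map => w; rewrite mem_filter => /andP[_ wW] /=; rewrite fW //.
  have : w.1 \in flatten [seq lI i | i : I] by rewrite -(perm_mem eI); exact: map_f.
  case/flatten_mapP=> j _ wj; case wi: (w.1 \in lI i).
    by rewrite (contr_tree_flow (treeI i) (fI i) _ wi) vI eqxx.
  rewrite (contr_tree_flow (treeI j) (fI j) _ wj) vI; case: eqP => // ji.
  by rewrite -ji wj in wi.
by rewrite sumn_count count_filter.
Qed.

(** * Path counts and conclusion *)

Lemma mem_inputs (S : net) : inputs S =i free_in S.
Proof. by move=> p; rewrite seq_fsetE mem_filter andbC. Qed.

Lemma mem_outputs (S : net) : outputs S =i free_out S.
Proof. by move=> p; rewrite seq_fsetE mem_filter andbC. Qed.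

Lemma card_eq_ord_size {T : choiceType} {A : set T} {s : seq T} {n : nat} :
  uniq s -> (forall x, A x <-> x \in s) -> n = size s -> A #= [set: 'I_n]%classic.
Proof.
move=> us As ->.
have -> : A = [set` [fset x in s]%fset]%classic.
  apply/seteqP; split=> x /=; first by move=> /As xs; rewrite inE.
  by rewrite inE => /As.
apply: card_eq_trans card_II; apply/card_eq_fsetP.
by rewrite card_fseq undup_id.
Qed.

(** The source term is the indicator of [i]; it vanishes on wire ends and cell ports because [i] is
    a free source, so the path counts solve the system with [k = 0]. *)
Lemma path_flow {S : net} {h} {i : port} : {in arcs S, forall d, h d.1.1 < h d.2} ->
  free_in S i ->
  exists v, [/\ all (flow 0 v) S, forall j, free_in S j -> v j = (j == i) &
    forall o, free_out S o -> paths S i o #= [set: 'I_(v o)]%classic].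
Proof.
move=> rk fi; have wS := net_well_formed S; have /andP[iS ic] := fi.
have [P [sizeP uniqP memP]] := path_lists i wS rk.
exists (size \o P); split.
- apply: (flow_of_equation wS sizeP) => c cS.
  have ncell p : p \in cell_ports S -> ((p == i) : nat) = 0.
    by move=> pc; case: eqP => // pi; rewrite -pi pc in ic.
  case: c cS => [s e|p a b|p a b|p|p] cS //.
  + by case: eqP => // ei; have := source_not_end wS iS; rewrite -ei (mem_wire_end cS).
  + by have [_ a1 b1] := mem_contr cS; rewrite !ncell // mem_cat ?a1 ?b1.
  + by have [p1 _ _] := mem_cocontr cS; rewrite ncell // mem_cat p1.
  + by rewrite ncell // mem_cat (mem_coweak cS).
- by move=> j fj; rewrite /= sizeP incoming_free_in ?addn0.
move=> o _; apply: (card_eq_ord_size (uniqP o)) => // -[p st].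
rewrite memP /paths /= /trail_start /trail_stop /is_path /trail_edges /=; split.
  case=> /andP[w srt] pi <-; rewrite pi in w *; rewrite !eqxx andbT /=.
  (* As [i] is on no cell, the first edge is a wire, and [i] is its source. *)
  apply: walk_directed => // e q st' stE; move: w; rewrite stE /= => /and3P[eS lk _].
  have [/(arc_kind wS)|/(arc_kind wS)] /= := edge_arc eS lk; case: ifP => _ /andP[i1 i2] //.
  - by case/negP: ic; rewrite mem_cat i1 orbT.
  - by case/negP: ic; rewrite mem_cat i2.
case/and3P=> /eqP pi dir /eqP ->; split=> //.
exact: directed_walk dir.
Qed.

Theorem mainTheorem13 (S : net) (hS : routing_net S) :
  unique (@describes_normal_form S) (interp S) /\
  forall (i : inputs S) (o : outputs S),
    paths S (val i) (val o) #= [set: 'I_(interp S (i, o))]%classic.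
Proof.
have [h rk] := correct_ranked hS; have wS := net_well_formed S.
(* Any candidate counts the paths, whichever normal form it describes: this gives both uniqueness
   and the formula. *)
have counts (R : multirelation (inputs S) (outputs S)) : describes_normal_form R ->
    forall i o, paths S (val i) (val o) #= [set: 'I_(R (i, o))]%classic.
  case=> S' [/conserves_reduces[_ cons] _ area] i o.
  have fi : free_in S (val i) by have := valP i; rewrite mem_inputs.
  have fo : free_out S (val o) by have := valP o; rewrite mem_outputs.
  have [v [fv vI cardP]] := path_flow rk fi.
  have [v' fv' vv'] := cons v fv.
  rewrite -(routing_area_flow i o area fv') => [|j]; first by rewrite vv' ?fo ?orbT //; exact: cardP.
  have fj : free_in S (val j) by have := valP j; rewrite mem_inputs.
  by rewrite vv' ?fj // vI.
(* Existence: the unit-source solution makes reduction reach a normal net, which the transported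
   rank shows to be a routing area. *)
have [R RS] : exists R : multirelation (inputs S) (outputs S), describes_normal_form R.
  have [u fu] := potential_exists wS rk.
  have [S' [red nS' [h' ih']]] := reduces_to_normal fu (ranked_increasing rk).
  have [[si so] _] := conserves_reduces red.
  have [p|p|R area] := @normal_routing_area S' h' (inputs S) (outputs S) nS' ih'.
  - by rewrite mem_inputs; exact: si.
  - by rewrite mem_outputs; exact: so.
  by exists R, S'.
(* A candidate exists, so [xget] returns one rather than its default. *)
have interpP : describes_normal_form (interp S) by apply: xgetPex; exists R.
split; last exact: counts.
split=> // R' R'S; apply/ffunP => -[i o].
have := card_eq_trans (card_esym (counts _ interpP i o)) (counts _ R'S i o).
move=> e; apply/card_eq_II.
by apply: card_eq_trans card_II _; apply: card_eq_trans e _; apply: card_esym; exact: card_II.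
Qed.
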